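(* Let $n\ge 2$, $\Omega=(0,1)^n$ and $T>0$. For any finite subset $\omega\subset\Omega$, the heat equation on $\Omega$ with Dirichlet boundary conditions is not observable from $\omega$ at time $T$.
   Context: Heat equation: for $u_0\in L^2(\Omega)$, $u$ denotes the unique weak solution in $L^2(0,T;H^1_0(\Omega))\cap H^1(0,T;H^{-1}(\Omega))$ of $\partial_t u-\Delta u=0$ in $(0,T)\times\Omega$, $u=0$ on $(0,T)\times\partial\Omega$, $u(0,\cdot)=u_0$. For $t>0$, $u(t,\cdot)$ is identified with its continuous representative. Observability: the heat equation is observable from $\omega\subset\Omega$ at time $T>0$ if there exists $C=C(\Omega,\omega,T)>0$ such that for every $u_0\in L^2(\Omega)$ the solution $u$ satisfies $\|u(T,\cdot)\|_{L^\infty(\Omega)}\le C\int_0^T\sup_{x\in\omega}|u(t,x)|\,dt$ (the supremum over the empty set being $0$). *)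

(* Defs.v *)
From HB Require Import structures.
From mathcomp Require Import all_boot all_order all_algebra.
From mathcomp Require Import all_classical all_reals all_analysis.

Set Implicit Arguments.
Unset Strict Implicit.
Unset Printing Implicit Defensive.

Import Order.TTheory GRing.Theory Num.Theory.
Import numFieldNormedType.Exports.

Local Open Scope classical_set_scope.
Local Open Scope ring_scope.

Definition rV_display : measure_display -> measure_display.
Proof. exact. Qed.

(* The Borel sigma-algebra of R^n, generated by the coordinates *)
Section measurable_rV.
Context {R : realType} (n : nat).

Let coors : 'I_n -> 'rV[R]_n -> R := fun i x => x ord0 i.

Let rV_set0 : g_sigma_preimage coors set0.
Proof. exact: sigma_algebra0. Qed.

Let rV_setC A : g_sigma_preimage coors A -> g_sigma_preimage coors (~` A).
Proof. exact: sigma_algebraC. Qed.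

Let rV_bigcup (F : _^nat) : (forall i, g_sigma_preimage coors (F i)) ->
  g_sigma_preimage coors (\bigcup_i (F i)).
Proof. exact: sigma_algebra_bigcup. Qed.

HB.instance Definition _ := @isMeasurable.Build (rV_display default_measure_display)
  'rV[R]_n (g_sigma_preimage coors) rV_set0 rV_setC rV_bigcup.

Lemma measurable_coord (i : 'I_n) :
  measurable_fun [set: 'rV[R]_n] (fun x : 'rV[R]_n => x ord0 i).
Proof.
move=> _ Y mY; rewrite setTI; apply: sub_sigma_algebra => /=.
rewrite -bigcup_seq/=; exists i => /=; first by rewrite mem_index_enum.
by exists Y => //; rewrite setTI.
Qed.

End measurable_rV.

Lemma measurable_fun_coordP d (T : measurableType d) (R : realType) n
    (f : T -> 'rV[R]_n) :
  measurable_fun [set: T] f <->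
  forall i, measurable_fun [set: T] (fun x => f x ord0 i).
Proof.
split=> [mf i|mf].
  exact: (measurableT_comp (measurable_coord i) mf).
have mfS : g_sigma_preimage (fun i : 'I_n => (fun x : 'rV[R]_n => x ord0 i) \o f)
    `<=` measurable.
  apply: smallest_sub; first exact: sigma_algebra_measurable.
  rewrite -bigcup_seq/= => A [i _ [B mB <-]].
  exact: mf.
rewrite g_sigma_preimage_comp in mfS.
by move=> _ A mA; apply: mfS; exists A.
Qed.

Section lebesgue_Rn.
Context {R : realType}.

Definition row_cons n (p : R * 'rV[R]_n) : 'rV[R]_(1 + n) :=
  row_mx p.1%:M p.2.

Definition row_uncons n (x : 'rV[R]_(1 + n)) : R * 'rV[R]_n :=
  (x ord0 (lshift n ord0), rsubmx x).

Lemma row_cons0 n (p : R * 'rV[R]_n) :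
  (row_cons p : 'rV[R]_n.+1) ord0 ord0 = p.1.
Proof.
transitivity (row_mx p.1%:M p.2 ord0 (lshift n ord0)); last first.
  by rewrite row_mxEl mxE eqxx mulr1n.
by rewrite /row_cons; congr (fun_of_matrix _ _ _); exact/val_inj.
Qed.

Lemma row_consS n (p : R * 'rV[R]_n) (i : 'I_n) :
  (row_cons p : 'rV[R]_n.+1) ord0 (lift ord0 i) = p.2 ord0 i.
Proof.
transitivity (row_mx p.1%:M p.2 ord0 (rshift 1 i)); last by rewrite row_mxEr.
by rewrite /row_cons; congr (fun_of_matrix _ _ _); exact/val_inj.
Qed.

Lemma row_consK n : cancel (@row_cons n) (@row_uncons n).
Proof.
by case=> a y; rewrite /row_uncons /row_cons /= row_mxKr row_mxEl mxE mulr1n.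
Qed.

Lemma row_unconsK n : cancel (@row_uncons n) (@row_cons n).
Proof.
move=> x; rewrite /row_uncons /row_cons /= -[RHS]hsubmxK; congr row_mx.
by apply/matrixP => i j; rewrite !mxE !ord1 eqxx mulr1n.
Qed.

Lemma measurable_row_cons n : measurable_fun setT (@row_cons n).
Proof.
apply/measurable_fun_coordP => i; rewrite /row_cons.
case: (split_ordP i) => j -> /=.
  under eq_fun do rewrite row_mxEl mxE (ord1 j) eqxx mulr1n.
  exact: measurable_fst.
under eq_fun do rewrite row_mxEr.
exact: (measurableT_comp (measurable_coord j) measurable_snd).
Qed.

Lemma measurable_row_uncons n : measurable_fun setT (@row_uncons n).
Proof.
apply: measurable_fun_pair; first exact: measurable_coord.
apply/measurable_fun_coordP => j /=.
under eq_fun do rewrite mxE.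
exact: measurable_coord.
Qed.

Section step.
Context n (mu : {sigma_finite_measure set 'rV[R]_n -> \bar R}).

Definition lebesgue_step : set 'rV[R]_(1 + n) -> \bar R :=
  pushforward (@lebesgue_measure R \x mu)%E (@row_cons n).

Let step_measure : {measure set 'rV[R]_(1 + n) -> \bar R} :=
  measure_function_pushforward__canonical__measure_function_Measure
    (@lebesgue_measure R \x mu)%E (@measurable_row_cons n).

Let lebesgue_step0 : lebesgue_step set0 = 0%E.
Proof. exact: (measure0 step_measure). Qed.

Let lebesgue_step_ge0 A : (0 <= lebesgue_step A)%E.
Proof. exact: (measure_ge0 step_measure). Qed.

Let lebesgue_step_sigma_additive : semi_sigma_additive lebesgue_step.
Proof. exact: (@measure_semi_sigma_additive _ _ _ step_measure). Qed.

HB.instance Definition _ := isMeasure.Build _ _ _ lebesgue_step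
  lebesgue_step0 lebesgue_step_ge0 lebesgue_step_sigma_additive.

Let lebesgue_step_sigma_finite : sigma_finite setT lebesgue_step.
Proof.
have /sigma_finiteP[F [TF ndF Foo]] := sigma_finiteT (@lebesgue_measure R).
have /sigma_finiteP[G [TG ndG Goo]] := sigma_finiteT mu.
exists (fun k => @row_uncons n @^-1` (F k `*` G k)).
  rewrite -preimage_bigcup (_ : \bigcup_k _ = setT) ?preimage_setT//.
  rewrite -setXTT TF TG predeqE => -[x y]; split.
    by move=> [k _ []/= ? ?]; split; exists k.
  move=> [/= [k _ Fkx] [l _ Gly]]; exists (maxn k l) => //; split.
  - by move: x Fkx; exact/subsetPset/ndF/leq_maxl.
  - by move: y Gly; exact/subsetPset/ndG/leq_maxr.
move=> k; have [mF Fk] := Foo k; have [mG Gk] := Goo k; split.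
  rewrite -[X in measurable X]setTI; apply: measurable_row_uncons => //.
  exact: measurableX.
rewrite /lebesgue_step /pushforward -comp_preimage.
rewrite (_ : _ \o _ = id); last by apply/funext => p /=; rewrite row_consK.
rewrite preimage_id product_measure1E// lte_mul_pinfty//.
by rewrite ge0_fin_numE.
Qed.

HB.instance Definition _ := Measure_isSigmaFinite.Build _ _ _
  lebesgue_step lebesgue_step_sigma_finite.

End step.

Fixpoint lebesgue_rV n : {sigma_finite_measure set 'rV[R]_n -> \bar R} :=
  match n with
  | 0%N => \d_(0 : 'rV[R]_0)
  | m.+1 => lebesgue_step (lebesgue_rV m)
  end.

Lemma lebesgue_rV_box n (I : 'I_n -> set R) :
  (forall i, measurable (I i)) ->
  lebesgue_rV n [set x | forall i, I i (x ord0 i)] =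
  (\prod_(i < n) lebesgue_measure (I i))%E.
Proof.
elim: n I => [|n IH] I mI.
  rewrite big_ord0 /= diracE mem_set//=; by case.
set B := [set y : 'rV[R]_n | forall i, I (lift ord0 i) (y ord0 i)].
have mB : measurable B.
  rewrite (_ : B = \bigcap_(i in [set: 'I_n])
      ((fun x : 'rV[R]_n => x ord0 i) @^-1` I (lift ord0 i))); last first.
    by apply/seteqP; split=> x /= h i => [_|]; exact: h.
  apply: fin_bigcap_measurable => // i _; rewrite -[X in measurable X]setTI.
  exact: measurable_coord.
rewrite big_ord_recl -(IH (fun i => I (lift ord0 i)))// -/B.
rewrite /= /lebesgue_step /pushforward -product_measure1E//.
congr ((_ \x _)%E _); apply/seteqP; split=> -[a y] /=.
  move=> h; split=> [|i]; first by have := h ord0; rewrite row_cons0.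
  by have := h (lift ord0 i); rewrite row_consS.
move=> [ha hy] i; case: (unliftP ord0 i) => [j|] ->.
  by rewrite row_consS; exact: hy.
by rewrite row_cons0.
exact: (mI ord0).
Qed.

End lebesgue_Rn.

Section sobolev.
Context {R : realType} {n : nat}.
Implicit Types (D : set 'rV[R]_n) (f g phi : 'rV[R]_n -> R).
Implicit Types (F G : 'I_n -> 'rV[R]_n -> R).

Notation dx := (@lebesgue_rV R n).

Definition partial (i : 'I_n) f : 'rV[R]_n -> R :=
  fun x => 'D_(delta_mx ord0 i) f x.

Definition iter_partial (s : seq 'I_n) f : 'rV[R]_n -> R := foldr partial f s.

Definition smooth f := forall s : seq 'I_n,
  continuous (iter_partial s f) /\
  forall (i : 'I_n) x, derivable (iter_partial s f) x (delta_mx ord0 i).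

(* C_c^oo(D) *)
Definition test_function D phi :=
  [/\ smooth phi,
      compact (closure [set x | phi x != 0]) &
      closure [set x | phi x != 0] `<=` D].

Definition L2norm D f : \bar R := 'N[dx]_2%:E [EFin \o (f \_ D)].

Definition Linfty_norm D f : \bar R := 'N[dx]_+oo [EFin \o (f \_ D)].

Definition L2 D : set ('rV[R]_n -> R) :=
  [set f | measurable_fun D f /\ (L2norm D f < +oo)%E].

Definition L2dot D f g : R := (\int[dx]_(x in D) (f x * g x))%R.

Definition weak_partial D (i : 'I_n) f g :=
  forall phi, test_function D phi -> L2dot D f (partial i phi) = - L2dot D g phi.

(* An element of H^1(D) is presented as a pair consisting of a function and its
   weak gradient; the latter is determined almost everywhere by the former. *)
Definition sobolev_pair : zmodType :=
  (('rV[R]_n -> R) * ('I_n -> 'rV[R]_n -> R))%type.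

Definition H1 D : set sobolev_pair :=
  [set w | L2 D w.1 /\ forall i, L2 D (w.2 i) /\ weak_partial D i w.1 (w.2 i)].

Definition H1norm D (w : sobolev_pair) : \bar R :=
  ((L2norm D w.1 ^+ 2 + \sum_(i < n) L2norm D (w.2 i) ^+ 2) `^ 2^-1)%E.

Definition with_gradient phi : sobolev_pair := (phi, partial^~ phi).

(* H^1_0(D): the closure of C_c^oo(D) in H^1(D) *)
Definition H10 D : set sobolev_pair :=
  [set w | H1 D w /\ exists phi : nat -> 'rV[R]_n -> R,
    (forall k, test_function D (phi k)) /\
    H1norm D (w - with_gradient (phi k)) @[k --> \oo] --> 0%E].

(* The norm of H^{-1}(D), the dual of H^1_0(D); a functional is represented by
   its action on functions, and only its values on H^1_0(D) matter. *)
Definition Hm1norm D (l : ('rV[R]_n -> R) -> R) : \bar R :=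
  ereal_sup [set `|l w.1|%:E | w in H10 D `&` [set w | (H1norm D w <= 1)%E]].

Definition Hm1 D : set (('rV[R]_n -> R) -> R) :=
  [set l | (forall (a : R) v w, H10 D v -> H10 D w ->
              l (a \*: v.1 + w.1) = a * l v.1 + l w.1) /\
           (Hm1norm D l < +oo)%E].

(* L^2(D) embedded in H^{-1}(D) *)
Definition L2_Hm1 D f : ('rV[R]_n -> R) -> R := L2dot D f.

End sobolev.

Section bochner.
Context {R : realType}.
Implicit Types (T : R) (E : zmodType).

Notation dt := (@lebesgue_measure R).

Definition simple_curve E (V : set E) (s : R -> E) :=
  [/\ finite_set (range s),
      (forall e, measurable (s @^-1` [set e] : set R)) &
      range s `<=` V].

Definition strongly_measurable E T (V : set E) (N : E -> \bar R) (f : R -> E) :=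
  exists s : nat -> R -> E,
    (forall k, simple_curve V (s k)) /\
    {ae dt, forall t, t \in `]0, T[ -> N (f t - s k t) @[k --> \oo] --> 0%E}.

(* L^2(0, T; V), where V is a subspace of E with norm N *)
Definition bochner_L2 E T (V : set E) (N : E -> \bar R) : set (R -> E) :=
  [set f | [/\ {ae dt, forall t, t \in `]0, T[ -> V (f t)},
               strongly_measurable T V N f &
               (\int[dt]_(t in `]0%R, T[) (N (f t)) ^+ 2 < +oo)%E]].

(* C_c^oo(]0, T[) *)
Definition time_test_function T (theta : R -> R) :=
  [/\ (forall k t, derivable (derive1n k theta) t 1),
      compact (closure [set t | theta t != 0]) &
      closure [set t | theta t != 0] `<=` `]0, T[].

End bochner.

Section heat.
Context {R : realType} {n : nat}.
Implicit Types (D omega : set 'rV[R]_n) (T : R).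

Notation dt := (@lebesgue_measure R).
Notation dx := (@lebesgue_rV R n).

(* v is the weak derivative on (0, T) of the H^{-1}(D)-valued curve g; equality
   of the two Bochner integrals in H^{-1}(D) is tested on each w in H^1_0(D). *)
Definition weak_time_derivative D T (g v : R -> ('rV[R]_n -> R) -> R) :=
  forall theta, time_test_function T theta -> forall w, H10 D w ->
    \int[dt]_(t in `]0, T[) (derive1 theta t * g t w.1) =
    - \int[dt]_(t in `]0, T[) (theta t * v t w.1).

(* u is the solution on (0, T) x D with initial datum u0: Du is its spatial weak
   gradient, v its time derivative, and u its representative in C([0, T]; L^2(D))
   with u t continuous on D for 0 < t <= T. *)
Definition heat_solution D T (u0 : 'rV[R]_n -> R) (u : R -> 'rV[R]_n -> R) :=
  exists (Du : R -> 'I_n -> 'rV[R]_n -> R) (v : R -> ('rV[R]_n -> R) -> R),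
    [/\ bochner_L2 T (H10 D) (H1norm D) (fun t => (u t, Du t) : sobolev_pair),
        [/\ bochner_L2 T (Hm1 D) (Hm1norm D) (fun t => L2_Hm1 D (u t)),
            bochner_L2 T (Hm1 D) (Hm1norm D) v &
            weak_time_derivative D T (fun t => L2_Hm1 D (u t)) v],
        {ae dt, forall t, t \in `]0, T[ -> forall w, H10 D w ->
          v t w.1 + \sum_(i < n) L2dot D (Du t i) (w.2 i) = 0},
        [/\ (forall t : R, t \in `[0, T] -> L2 D (u t)),
            (forall t : R, t \in `[0, T] ->
              L2norm D (u s - u t) @[s --> within `[0, T] (nbhs t)] --> 0%E) &
            {ae dx, forall x, D x -> u 0 x = u0 x}] &
        forall t : R, t \in `]0, T] -> {within D, continuous (u t)}].

(* [set 0%E] makes the supremum over the empty set 0. *)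
Definition sup_abs omega (f : 'rV[R]_n -> R) : \bar R :=
  ereal_sup ([set `|f x|%:E | x in omega] `|` [set 0%E]).

Definition observable D omega T :=
  exists C : R, 0 < C /\
    forall u0 u, L2 D u0 -> heat_solution D T u0 u ->
      (Linfty_norm D (u T) <= C%:E * \int[dt]_(t in `]0%R, T[) sup_abs omega (u t))%E.

Definition unit_cube : set 'rV[R]_n := [set x | forall i, 0 < x ord0 i < 1].

End heat.

(* Main.v *)
Require Import Defs.
From HB Require Import structures.
From mathcomp Require Import all_boot all_order all_algebra.
From mathcomp Require Import all_classical all_reals all_analysis.
From mathcomp Require Import measurable_realfun ess_sup_inf zify ring lra.
Import Order.TTheory GRing.Theory Num.Theory.
Import numFieldNormedType.Exports.
Local Open Scope classical_set_scope.
Local Open Scope ring_scope.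
Set Implicit Arguments.
Unset Strict Implicit.
Unset Printing Implicit Defensive.

(** The Dirichlet Laplacian of the cube has eigenvalues of arbitrarily large
multiplicity as soon as the dimension is at least two.  The products of sines
with frequencies k_i are eigenfunctions, with eigenvalue pi^2 times the sum of
the squares of the k_i, and [pythagorean_family] provides as many frequency
vectors as desired with the same sum of squares: the first two frequencies are
the legs of integer right triangles with a common hypotenuse, and the other
ones are 1.  If there are more such modes than points in omega, linear algebra
yields a nontrivial combination f of them that vanishes at every point of omega
([eigenfunction_vanishing_on]); it is not identically zero because sines of
distinct frequencies are linearly independent ([sine_independence]).  Then
u(t, x) = exp (- lam t) f(x) solves the heat equation and vanishes on omega at
all times, so the right-hand side of the observability inequality is 0, whereas
u(T, .) is a nonzero continuous function, whose essential supremum is positive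
([Linfty_norm_gt0]).

Most of the work is to see that u is a weak solution ([heat_solution_eigenmode]).
The explicit functions are taken in the algebra [coordalg] generated by the
smooth functions of one coordinate: it is stable under partial derivatives, it contains
the eigenfunctions and, thanks to the flat function exp (-1/y), the cutoffs that
approximate them by test functions.
- Such a function f has its classical derivatives as weak derivatives
  ([weak_partial_C1]): the integral of a compactly supported derivative along
  every line in direction i is zero, hence so is its integral over the whole
  space, by Fubini ([integral_lines0]).
- If moreover |f| is bounded by a multiple of the distance to each face of the
  cube, f belongs to H^1_0 ([H10_with_gradient]): multiply f by a product of
  cutoffs whose derivatives blow up no faster than the inverse of this distance.
- The equation for f then holds against test functions, hence against H^1_0
  by density ([weak_eigen_equation]).
- A curve t |-> g(t) f inherits its Bochner measurability and integrability
  from the real function g ([bochner_L2_separated]). *)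

(** * Borel functions and Lebesgue measure on R^n *)

Section euclidean_measure.
Context {R : realType}.
Notation dx n := (@lebesgue_rV R n).

Let gridpoint n (k : nat) (q : 'rV[int]_n) : 'rV[R]_n :=
  map_mx (fun z : int => z%:~R / k.+1%:R) q.

Let gridfloor n (k : nat) (x : 'rV[R]_n) : 'rV[int]_n :=
  map_mx (fun t => Num.floor (t * k.+1%:R)) x.

Let cvg_grid n (x : 'rV[R]_n) :
  gridpoint k (gridfloor k x) @[k --> \oo] --> x.
Proof.
apply/cvgrPdist_lt => e e0; near=> k.
rewrite -[ltLHS]/(mx_norm _) mx_normrE.
apply/bigmax_ltP; split => // -[i j] _ /=; rewrite !mxE.
have k0 : 0 < k.+1%:R :> R by rewrite ltr0n.
set t := x i j.
have fl := floor_itv (t * k.+1%:R).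
set z := (Num.floor (t * k.+1%:R))%:~R in fl *.
have -> : t - z / k.+1%:R = (t * k.+1%:R - z) / k.+1%:R.
  by rewrite mulrBl mulfK // gt_eqF.
have /andP[fl1 fl2] := fl.
rewrite ger0_norm ?divr_ge0 ?subr_ge0 ?(ltW k0)//.
apply: (@le_lt_trans _ _ (1 / k.+1%:R)).
  rewrite ler_pM2r ?invr_gt0//.
  by rewrite /z; move: fl2; rewrite intrD /=; lra.
by rewrite div1r; near: k; exact: near_infty_natSinv_lt (PosNum e0).
Unshelve. all: by end_near. Qed.

(** The sigma-algebra is generated by the coordinates whereas continuity refers
to the norm topology; the two meet through the grids of mesh 1/(k+1): rounding x
down to the grid is a measurable map with countable range, and f of the rounded
point converges to f x. *)
Lemma continuous_measurable_rV n (f : 'rV[R]_n -> R) :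
  continuous f -> measurable_fun setT f.
Proof.
move=> cf.
apply: (@measurable_fun_cvg _ _ _ _ (fun k x => f (gridpoint k (gridfloor k x)))).
  move=> k _ A mA; rewrite setTI.
  rewrite (_ : _ @^-1` _ = \bigcup_q
     [set x | gridfloor k x = q /\ A (f (gridpoint k q))]); last first.
    apply/seteqP; split => [x /= Ax|x [q _ /= [<-]]//].
    by exists (gridfloor k x).
  apply: countable_bigcupT_measurable => [|q]; first exact: countableP.
  have [Aq|nAq] := pselect (A (f (gridpoint k q))); last first.
    by rewrite (_ : mkset _ = set0)// -subset0 => x [].
  rewrite (_ : mkset _ = \bigcap_(i in [set: 'I_n])
      ((fun x : 'rV[R]_n => x ord0 i) @^-1`
       [set t | Num.floor (t * k.+1%:R) = q ord0 i])); last first.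
    apply/seteqP; split => [x [<- _] i _|x /= h]; first by rewrite /= mxE.
    by split=> //; apply/rowP => i; rewrite mxE; apply: (h i).
  apply: fin_bigcap_measurable => // i _; rewrite -[X in measurable X]setTI.
  apply: measurable_coord => //.
  rewrite (_ : mkset _ =
     `[(q ord0 i)%:~R / k.+1%:R, (q ord0 i + 1)%:~R / k.+1%:R[%classic) //.
  apply/seteqP; split => t /=; rewrite in_itv /= ler_pdivrMr ?ltr0n// ltr_pdivlMr ?ltr0n//.
    by move=> <-; exact: floor_itv.
  by move=> h; apply/eqP; rewrite floor_eq.
by move=> x _; apply: continuous_cvg; [exact: cf|exact: cvg_grid].
Qed.

Lemma measurable_unit_cube n : measurable (@unit_cube R n).
Proof.
rewrite (_ : unit_cube = \bigcap_(i in [set: 'I_n])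
    ((fun x : 'rV[R]_n => x ord0 i) @^-1` `]0, 1[%classic)); last first.
  apply/seteqP; split => [x h i _|x h i]; first by rewrite /= in_itv; exact: h.
  by have := h i I; rewrite /= in_itv.
apply: fin_bigcap_measurable => // i _; rewrite -[X in measurable X]setTI.
exact: measurable_coord.
Qed.

Lemma lebesgue_unit_cube n : dx n unit_cube = 1%E.
Proof.
rewrite (_ : unit_cube = [set x : 'rV[R]_n |
    forall i, `]0, 1[%classic (x ord0 i)]); last first.
  apply/seteqP; split => x /= h i; first by rewrite in_itv; exact: h.
  by have := h i; rewrite in_itv.
rewrite (lebesgue_rV_box (I := fun _ => `]0, 1[%classic))//.
rewrite big1// => i _.
by rewrite lebesgue_measure_itv /= lte_fin ltr01 oppr0 adde0.
Qed.

Lemma lebesgue_unit_cube_lty n : (dx n unit_cube < +oo)%E.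
Proof. by rewrite lebesgue_unit_cube ltry. Qed.

End euclidean_measure.

(** * The L^2 norm and inner product *)

Section square_integrable.
Context {R : realType} {n : nat} (D : set 'rV[R]_n).
Hypothesis mD : measurable D.
Hypothesis finD : (lebesgue_rV n D < +oo)%E.
Notation dx := (@lebesgue_rV R n).
Implicit Types f g : 'rV[R]_n -> R.

Lemma L2norm_ge0 f : (0 <= L2norm D f)%E.
Proof. exact: Lnorm_ge0. Qed.

Lemma L2normE f :
  L2norm D f = ((\int[dx]_(x in D) ((f x) ^+ 2)%:E) `^ 2^-1)%E.
Proof.
rewrite /L2norm unlock [in RHS]integral_mkcond; congr (_ `^ _)%E.
apply: eq_integral => x _ /=; rewrite !patchE; case: ifP => _.
  by rewrite (powR_mulrn 2)// real_normK ?num_real.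
by rewrite normr0 powR0.
Qed.

Let sqint_ge0 f : (0 <= \int[dx]_(x in D) ((f x) ^+ 2)%:E)%E.
Proof. by apply: integral_ge0 => x _; rewrite lee_fin sqr_ge0. Qed.

Lemma L2norm_sqrt f : (L2norm D f < +oo)%E ->
  L2norm D f = (Num.sqrt (fine (\int[dx]_(x in D) ((f x) ^+ 2)%:E)%E))%:E.
Proof.
rewrite L2normE => /(lty_poweRy (invr_neq0 _)) foo.
rewrite -[X in (X `^ _)%E]fineK; last by rewrite ge0_fin_numE ?sqint_ge0// foo.
by rewrite poweR_EFin powR12_sqrt// fine_ge0// sqint_ge0.
Qed.

Lemma L2normZ a f : measurable_fun D f ->
  L2norm D (fun x => a * f x) = (`|a|%:E * L2norm D f)%E.
Proof.
move=> mf; rewrite !L2normE.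
under eq_integral do rewrite exprMn EFinM.
rewrite ge0_integralZl_EFin ?sqr_ge0//; last 2 first.
- by move=> x _; rewrite lee_fin sqr_ge0.
- by apply/measurable_EFinP; exact: measurable_funX.
rewrite poweRM ?lee_fin ?sqr_ge0// poweR_EFin powR12_sqrt ?sqr_ge0//.
by rewrite sqrtr_sqr.
Qed.

Lemma L2norm_cst0 : L2norm D (fun _ => 0) = 0%E.
Proof.
rewrite L2normE; under eq_integral do rewrite expr0n /=.
by rewrite integral0 poweR0r.
Qed.

Lemma L2_bounded f M : measurable_fun D f -> (forall x, D x -> `|f x| <= M) ->
  L2 D f.
Proof.
move=> mf fM; split=> //; rewrite L2normE; apply: poweR_lty.
apply: (@le_lt_trans _ _ (\int[dx]_(x in D) (cst (M ^+ 2)%:E x))%E).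
  apply: ge0_le_integral => //.
  - by move=> x _; rewrite lee_fin sqr_ge0.
  - by apply/measurable_EFinP; exact: measurable_funX.
  - move=> x Dx; rewrite /= lee_fin -real_normK ?num_real//.
    by rewrite ler_sqr ?nnegrE ?fM// (le_trans _ (fM _ Dx)).
by rewrite integral_cst// lte_mul_pinfty// lee_fin sqr_ge0.
Qed.

Lemma L2Z a f : L2 D f -> L2 D (fun x => a * f x).
Proof.
move=> [mf fi]; split; first exact: measurable_funM.
by rewrite L2normZ// lte_mul_pinfty// lee_fin.
Qed.

Lemma L2norm_triangle f g : measurable_fun D f -> measurable_fun D g ->
  (L2norm D (fun x => f x + g x)%R <= L2norm D f + L2norm D g)%E.
Proof.
move=> /(measurable_restrictT _ mD) mf /(measurable_restrictT _ mD) mg.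
rewrite /L2norm; apply: le_trans (eminkowski _ mf mg _); last first.
  by rewrite lee_fin ler1n.
rewrite le_eqVlt; apply/orP; left; apply/eqP/eq_Lnorm => x /=.
by rewrite !patchE; case: ifP; rewrite ?addr0.
Qed.

Lemma L2D f g : L2 D f -> L2 D g -> L2 D (fun x => f x + g x).
Proof.
move=> [mf fi] [mg gi]; split; first exact: measurable_funD.
by rewrite (le_lt_trans (L2norm_triangle mf mg))// lte_add_pinfty.
Qed.

Lemma L2B f g : L2 D f -> L2 D g -> L2 D (fun x => f x - g x).
Proof.
move=> Lf /(L2Z (-1)) Lg; have := L2D Lf Lg.
by under eq_fun do rewrite mulN1r.
Qed.

(** Hoelder's inequality is stated for functions on the whole space; the
restrictions to D by zero reduce to it. *)
Let hoelder_L2 f g : measurable_fun D f -> measurable_fun D g ->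
  (\int[dx]_(x in D) `|(f x * g x)%:E| <= L2norm D f * L2norm D g)%E.
Proof.
move=> /(measurable_restrictT _ mD) mf /(measurable_restrictT _ mD) mg.
have := @hoelder _ _ _ dx _ _ 2 2 mf mg (ltr0n _ _) (ltr0n _ _).
rewrite Lnorm1; have -> : 2^-1 + 2^-1 = 1 :> R by lra.
move=> /(_ erefl); apply: le_trans.
rewrite le_eqVlt; apply/orP; left; apply/eqP; rewrite [LHS]integral_mkcond.
by apply: eq_integral => x _; rewrite /= !patchE; case: ifP; rewrite ?mul0r ?normr0.
Qed.

Lemma L2dot_integrable f g : L2 D f -> L2 D g ->
  dx.-integrable D (fun x => (f x * g x)%:E).
Proof.
move=> [mf fi] [mg gi]; apply/integrableP; split.
  by apply/measurable_EFinP; exact: measurable_funM.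
apply: le_lt_trans (hoelder_L2 mf mg) _.
by rewrite lte_mul_pinfty ?L2norm_ge0// ge0_fin_numE ?L2norm_ge0.
Qed.

Lemma L2dot_CauchySchwarz f g : L2 D f -> L2 D g ->
  (`|L2dot D f g|%:E <= L2norm D f * L2norm D g)%E.
Proof.
move=> Lf Lg; apply: le_trans (hoelder_L2 Lf.1 Lg.1).
have Ifg := L2dot_integrable Lf Lg.
rewrite EFin_normr_Rintegral//; apply: le_abse_integral => //.
exact: measurable_int Ifg.
Qed.

Lemma L2dotC f g : L2dot D f g = L2dot D g f.
Proof. by apply: eq_Rintegral => x _; rewrite mulrC. Qed.

Lemma L2dotDr f g h : L2 D f -> L2 D g -> L2 D h ->
  L2dot D f (fun x => g x + h x) = L2dot D f g + L2dot D f h.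
Proof.
move=> Lf Lg Lh; rewrite /L2dot -RintegralD//; try exact: L2dot_integrable.
by apply: eq_Rintegral => x _; rewrite mulrDr.
Qed.

Lemma L2dotZr a f g : L2 D f -> L2 D g ->
  L2dot D f (fun x => a * g x) = a * L2dot D f g.
Proof.
move=> Lf Lg; rewrite /L2dot -RintegralZl//; last exact: L2dot_integrable.
by apply: eq_Rintegral => x _; rewrite mulrCA.
Qed.

Lemma L2dotZl a f g : L2 D f -> L2 D g ->
  L2dot D (fun x => a * f x) g = a * L2dot D f g.
Proof. by move=> Lf Lg; rewrite L2dotC L2dotZr// L2dotC. Qed.

Lemma L2dotBr f g h : L2 D f -> L2 D g -> L2 D h ->
  L2dot D f (fun x => g x - h x) = L2dot D f g - L2dot D f h.
Proof.
move=> Lf Lg Lh; have := L2dotDr Lf Lg (L2Z (-1) Lh).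
by under eq_fun do rewrite mulN1r; move=> ->; rewrite L2dotZr// mulN1r.
Qed.

(** Only g - g_k needs to have small norm, by Cauchy-Schwarz; this is how limits
of test functions are taken in the weak formulations. *)
Lemma L2dot_cvg f g (g_ : nat -> 'rV[R]_n -> R) :
  L2 D f -> L2 D g -> (forall k, L2 D (g_ k)) ->
  L2norm D (fun x => g x - g_ k x) @[k --> \oo] --> 0%E ->
  L2dot D f (g_ k) @[k --> \oo] --> L2dot D f g.
Proof.
move=> Lf Lg Lg_ gg.
have c0 : fine (L2norm D (fun x => g x - g_ k x)) * fine (L2norm D f)
    @[k --> \oo] --> (0 : R).
  by rewrite -(mul0r (fine (L2norm D f))); apply: cvgMl; exact: (fine_cvg gg).
apply/cvgrPdist_le => e e0.
have /cvgrPdist_le/(_ _ e0) := c0; apply: filterS => k.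
rewrite sub0r normrN; apply: le_trans.
rewrite -L2dotBr//; apply: le_trans (ler_norm _).
rewrite -lee_fin EFinM muleC !fineK ?ge0_fin_numE ?L2norm_ge0 ?Lf.2
  ?(L2B Lg (Lg_ k)).2//.
by apply: L2dot_CauchySchwarz => //; exact: L2B.
Qed.

(** Dominated convergence, with a constant as dominating function. *)
Lemma L2norm_cvg0 (f_ : nat -> 'rV[R]_n -> R) M :
  (forall k, measurable_fun D (f_ k)) ->
  (forall k x, D x -> `|f_ k x| <= M) ->
  (forall x, D x -> f_ k x @[k --> \oo] --> 0) ->
  L2norm D (f_ k) @[k --> \oo] --> 0%E.
Proof.
move=> mf fM f0.
have -> : (fun k => L2norm D (f_ k)) =
    (fun k => (Num.sqrt (fine (\int[dx]_(x in D) ((f_ k x) ^+ 2)%:E)%E))%:E).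
  by apply/funext => k; rewrite L2norm_sqrt//; exact: (L2_bounded (mf k) (fM k)).2.
have [] := @dominated_convergence _ _ R dx D mD
  (fun k x => ((f_ k x) ^+ 2)%:E) (cst 0%E) (cst (M ^+ 2)%:E).
- by move=> k; apply/measurable_EFinP; exact: measurable_funX.
- exact: measurable_cst.
- apply: aeW => x Dx; apply/fine_cvgP; split; first exact: nearW.
  rewrite -[X in _ --> X](mulr0 0); under eq_fun do rewrite /= expr2.
  by apply: cvgM; exact: f0.
- apply/integrableP; split; first exact: measurable_cst.
  by rewrite /= integral_cst// lte_mul_pinfty.
- apply: aeW => x k Dx; rewrite /= lee_fin normrX.
  by rewrite ler_sqr ?nnegrE ?fM// (le_trans _ (fM k _ Dx)).
move=> _ _; rewrite integral0 => I0.
apply/cvg_EFin; first exact: nearW.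
rewrite -[X in _ --> X]sqrtr0; apply: continuous_cvg; first exact: sqrt_continuous.
exact: (fine_cvg I0).
Qed.

End square_integrable.

(** * Smooth functions of one variable *)

Section flat_functions.
Context {R : realType}.
Implicit Types (p : {poly R}) (h : R -> R) (y z : R).

Definition smooth_real h := forall k t, derivable (derive1n k h) t 1.

(** Smoothness is a coinductive property: a class of derivable functions that is
stable under derivation consists of smooth functions.  This avoids formulas for
the iterated derivatives. *)
Lemma smooth_real_coind (P : (R -> R) -> Prop) h :
  (forall g, P g -> (forall t, derivable g t 1) /\ P (derive1 g)) ->
  P h -> smooth_real h.
Proof.
move=> HP Ph k; have Pk : P (derive1n k h).
  by elim: k => [//|k IH]; rewrite derive1nS; exact: (HP _ IH).2.
exact: (HP _ Pk).1.
Qed.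

Lemma smooth_real_derivable h : smooth_real h -> forall t, derivable h t 1.
Proof. by move=> /(_ 0%N). Qed.
#[local] Arguments smooth_real_derivable [h] _ t.

Lemma smooth_real_derive1 h : smooth_real h -> smooth_real (derive1 h).
Proof. by move=> sh k t; have := sh k.+1 t; rewrite derive1Sn. Qed.

Lemma derivable_continuous h : (forall t, derivable h t 1) -> continuous h.
Proof.
by move=> dh t; apply/differentiable_continuous/derivable1_diffP; exact: dh.
Qed.

Lemma is_derive_affine h a b t : derivable h (a * t + b) 1 ->
  is_derive t 1 (fun s => h (a * s + b)) (a * derive1 h (a * t + b)).
Proof.
move=> /derivableP dh.
have dl : is_derive t 1 (fun s => a * s + b) a.
  have -> : (fun s : R => a * s + b) = (a *: id + cst b) by [].
  by apply: is_derive_eq; rewrite addr0 [a *: _]mulr1.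
have := @is_derive1_comp _ h (fun s => a * s + b) t _ _ dh dl.
by rewrite mulrC derive1E.
Qed.

Lemma smooth_real_affine h a b :
  smooth_real h -> smooth_real (fun t => h (a * t + b)).
Proof.
move=> sh; pose P g := exists c h', smooth_real h' /\
  g = c *: (fun t => h' (a * t + b)).
apply: (@smooth_real_coind P); last by exists 1, h; rewrite scale1r.
move=> _ [c [h' [sh' ->]]].
have d t := is_derive_affine (smooth_real_derivable sh' (a * t + b)).
split=> [t|]; first by apply: derivableZ; case: (d t).
exists (c * a), (derive1 h'); split; first exact: smooth_real_derive1.
apply/funext => t; rewrite derive1E deriveZ; last by case: (d t).
by case: (d t) => _ ->; rewrite fctE scalerA.
Qed.

Lemma smooth_real_sin : smooth_real sin.
Proof.
pose P (g : R -> R) := exists c b : R, g = c *: (fun t => sin (1 * t + b)).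
apply: (@smooth_real_coind P); last first.
  by exists 1, 0; apply/funext => t; rewrite fctE [RHS]mul1r mul1r addr0.
move=> _ [c [b ->]].
have d (t : R) : is_derive t 1 (fun s : R => sin (1 * s + b)) (cos (1 * t + b)).
  have [ds es] := is_derive_sin (1 * t + b).
  by apply: (is_derive_eq (is_derive_affine ds)); rewrite mul1r derive1E es.
split=> [t|]; first by apply: derivableZ; case: (d t).
exists c, (b + pi / 2); apply/funext => t; rewrite derive1E deriveZ.
  by case: (d t) => _ ->; rewrite fctE addrA sinDpihalf.
by case: (d t).
Qed.

(** The functions y |-> p(1/y) exp (-1/y), extended by 0 to y <= 0.  A polynomial
factor is allowed in order to have a class that is stable under derivation. *)
Definition flat p y := if 0 < y then p.[y^-1] * expR (- y^-1) else 0.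

Lemma exprn_expR_bound i z : 0 <= z -> z ^+ i <= i`!%:R * expR z.
Proof.
move=> z0; case: i => [|i].
  by rewrite expr0 fact0 mul1r (le_trans _ (expR_ge1Dx z))// lerDl.
have := expR_ge1Dxn i z0; have f0 : 0 < i.+1`!%:R :> R by rewrite ltr0n fact_gt0.
move=> /(le_trans _) le; rewrite mulrC -ler_pdivrMr//; apply: le; lra.
Qed.

Lemma horner_expR_bound p :
  exists2 K, 0 <= K & forall z, 0 <= z -> `|p.[z]| * expR (- z) <= K.
Proof.
exists (\sum_(i < size p) `|p`_i| * i`!%:R).
  by apply: sumr_ge0 => i _; rewrite mulr_ge0.
move=> z z0; rewrite expRN ler_pdivrMr ?expR_gt0// horner_coef.
rewrite (le_trans (ler_norm_sum _ _ _))// mulr_suml; apply: ler_sum => i _.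
rewrite normrM -mulrA ler_wpM2l// ger0_norm ?exprn_ge0//.
exact: exprn_expR_bound.
Qed.

Let is_derive_flat0 p : is_derive (0 : R) 1 (flat p) 0.
Proof.
suff h : h^-1 *: ((flat p \o shift 0) (h *: 1) - flat p 0) @[h --> 0^'] --> (0 : R).
  apply: DeriveDef; first by apply/cvg_ex; exists 0.
  exact: (cvg_lim _ h).
have [K K0 HK] := horner_expR_bound ('X^2 * p).
apply/cvgr0Pnorm_le => e e0; near=> h.
rewrite /= addr0 [h *: 1]mulr1 /flat ltxx subr0.
have h0 : h != 0 by near: h; exact: nbhs_dnbhs_neq.
case: ifPn => hp; last by rewrite scaler0 normr0 ltW.
rewrite normrZ normrM [`|expR _|]ger0_norm ?expR_ge0//.
have := HK h^-1; rewrite invr_ge0 => /(_ (ltW hp)).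
rewrite hornerM hornerXn normrM normrX -mulrA normfV [`|h|]gtr0_norm//.
set u := `|p.[_]| * _ => hu.
have -> : h^-1 * u = h * (h^-1 ^+ 2 * u) by field.
apply: (@le_trans _ _ (h * (K + 1))).
  by rewrite ler_wpM2l ?(ltW hp)// (le_trans hu)// lerDl.
rewrite -ler_pdivlMr ?ltr_wpDl//.
apply: le_trans (ler_norm _) _; near: h; apply: dnbhs0_le.
by rewrite divr_gt0// ltr_wpDl.
Unshelve. all: by end_near. Qed.

(** For y > 0 this is the chain rule; at 0 the difference quotient is y z^2 p(z)
exp(-z) with z = 1/y, and z^2 p(z) exp(-z) is bounded. *)
Lemma is_derive_flat p y :
  is_derive y 1 (flat p) (flat ((p - p^`()) * 'X^2) y).
Proof.
have [y0|y0|->] := ltgtP y 0.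
- have -> : flat ((p - p^`()) * 'X^2) y = 0 by rewrite /flat ltNge ltW.
  apply: (@near_eq_is_derive _ _ _ (cst 0)).
  near=> z; rewrite /flat ifF//; apply/negbTE; rewrite -leNgt ltW//.
  by near: z; exact: lt_nbhsl.
- apply: (@near_eq_is_derive _ _ _ (fun z => p.[z^-1] * expR (- z^-1))).
    near=> z; rewrite /flat ifT//; near: z; exact: lt_nbhsr.
  have dV : is_derive y 1 (fun z : R => z^-1) (- y ^- 2).
    apply: (is_derive_eq (@is_deriveV _ id y 1 1 (lt0r_neq0 y0) _)).
    exact: mulr1.
  have dN : is_derive y 1 (fun z : R => - z^-1) (y ^- 2).
    by rewrite -[y ^-2]opprK; exact: is_deriveN.
  have dp := is_derive1_comp (is_derive_poly p y^-1) dV.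
  have de := @is_derive1_comp _ _ (fun z => - z^-1) y _ _
    (is_derive_expR (- y^-1)) dN.
  apply: (is_derive_eq (is_deriveM dp de)).
  rewrite /flat y0 /= hornerM hornerXn hornerD hornerN.
  rewrite /GRing.scale /= exprVn; ring.
- have -> : flat ((p - p^`()) * 'X^2) 0 = 0 by rewrite /flat ltxx.
  exact: is_derive_flat0.
Unshelve. all: by end_near. Qed.

Lemma smooth_real_flat p : smooth_real (flat p).
Proof.
apply: (@smooth_real_coind (fun g => exists q, g = flat q)); last by exists p.
move=> _ [q ->]; split=> [t|]; first by case: (is_derive_flat q t).
exists ((q - q^`()) * 'X^2); apply/funext => t; rewrite derive1E.
by case: (is_derive_flat q t).
Qed.

End flat_functions.
Arguments smooth_real_derivable [R h] _ t.

(** * The algebra generated by functions of one coordinate *)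

Section coordinate_algebra.
Context {R : realType} {n : nat}.
Notation E i := (delta_mx ord0 i : 'rV[R]_n).
Implicit Types (f g : 'rV[R]_n -> R) (x : 'rV[R]_n) (h : R -> R).

Lemma is_derive_line f i x t : derivable f (x + t *: E i) (E i) ->
  is_derive t 1 (fun s : R => f (x + s *: E i)) (partial i f (x + t *: E i)).
Proof.
have q : (fun h : R => h^-1 *: (((fun s : R => f (x + s *: E i)) \o shift t) (h *: 1)
                       - f (x + t *: E i)))
       = (fun h : R => h^-1 *: ((f \o shift (x + t *: E i)) (h *: E i)
                       - f (x + t *: E i))).
  apply/funext => h /=; congr (_ *: (f _ - _)).
  by rewrite [h *: 1]mulr1 scalerDl addrCA.
by move=> df; apply: DeriveDef; rewrite /partial /derivable /derive q.
Qed.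

(** A directional derivative along a coordinate axis only depends on the
restriction of f to the line through x, here presented by g. *)
Lemma is_derive_slice f (g : R -> R) l x :
  (forall k, f (k *: E l + x) = g (k + x ord0 l)) ->
  derivable g (x ord0 l) 1 -> is_derive x (E l) f (derive1 g (x ord0 l)).
Proof.
move=> fg dg.
have q : (fun k : R => k^-1 *: ((f \o shift x) (k *: E l) - f x)) =
         (fun k : R => k^-1 *: ((g \o shift (x ord0 l)) (k *: 1) - g (x ord0 l))).
  apply/funext => k; rewrite /= fg [k *: 1]mulr1.
  by have := fg 0; rewrite scale0r !add0r => ->.
by apply: DeriveDef; rewrite ?derive1E /derivable /derive q.
Qed.

Lemma coord_line l i x (k : R) :
  (k *: E l + x) ord0 i = if i == l then k + x ord0 l else x ord0 i.
Proof.
rewrite !mxE eqxx; case: eqP => [->|] /=; first by rewrite mulr1.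
by rewrite mulr0 add0r.
Qed.

Lemma coordD_line l i x (k : R) :
  (x + k *: E l) ord0 i = x ord0 i + (if i == l then k else 0).
Proof. by rewrite !mxE eqxx; case: (i == l); rewrite ?mulr1 ?mulr0. Qed.

Lemma is_derive_coord h i l x : derivable h (x ord0 i) 1 ->
  is_derive x (E l) (fun y : 'rV[R]_n => h (y ord0 i))
    (if i == l then derive1 h (x ord0 i) else 0).
Proof.
move=> dh; have [il|/negbTE il] := eqVneq i l.
  subst l; apply: (@is_derive_slice _ h) => [k|//]; congr (h _).
  by have := coord_line i i x k; rewrite eqxx.
apply: is_derive_eq.
  apply: (@is_derive_slice _ (cst (h (x ord0 i)))) => [k|]; last exact: derivable_cst.
  by congr (h _); have := coord_line l i x k; rewrite il.
exact: derive1_cst.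
Qed.

(** All the explicit functions of the proof (eigenfunctions, cutoffs, and their
derivatives) lie in this algebra, so their smoothness is obtained once and for
all from its stability under partial derivatives. *)
Inductive coordalg : ('rV[R]_n -> R) -> Prop :=
| coordalg_coord i h of smooth_real h : coordalg (fun x => h (x ord0 i))
| coordalg_cst c : coordalg (cst c)
| coordalgD f g of coordalg f & coordalg g : coordalg (f + g)
| coordalgM f g of coordalg f & coordalg g : coordalg (f * g).

Lemma coordalg_derivable f i x : coordalg f -> derivable f x (E i).
Proof.
elim=> [l h sh|c|g h _ dg _ dh|g h _ dg _ dh].
- by case: (@is_derive_coord h l i x (smooth_real_derivable sh _)).
- exact: derivable_cst.
- exact (derivableD dg dh).
- exact (derivableM dg dh).
Qed.

Lemma coordalg_continuous f : coordalg f -> continuous f.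
Proof.
elim=> [l h sh|c|g h _ cg _ ch|g h _ cg _ ch] x.
- apply: continuous_comp; first exact: coord_continuous.
  by apply: derivable_continuous => t; exact: smooth_real_derivable.
- exact: cst_continuous.
- by apply: continuousD; [exact: cg|exact: ch].
- by apply: continuousM; [exact: cg|exact: ch].
Qed.

Lemma partial_coord i l h : smooth_real h ->
  partial l (fun x => h (x ord0 i)) =
  fun x => if i == l then derive1 h (x ord0 i) else 0.
Proof.
move=> sh; apply/funext => x.
by case: (@is_derive_coord h i l x (smooth_real_derivable sh _)).
Qed.

Lemma partial_cst l c : partial l (cst c : 'rV[R]_n -> R) = cst 0.
Proof. by apply/funext => x; rewrite /partial derive_cst. Qed.

Lemma partialD l f g x :
  derivable f x (E l) -> derivable g x (E l) ->
  partial l (f + g) x = partial l f x + partial l g x.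
Proof. exact: deriveD. Qed.

Lemma partialM l f g x :
  derivable f x (E l) -> derivable g x (E l) ->
  partial l (f * g) x = f x * partial l g x + g x * partial l f x.
Proof. exact: deriveM. Qed.

Lemma partialZ l c f x : derivable f x (E l) ->
  partial l (fun y => c * f y) x = c * partial l f x.
Proof.
move=> df; have := @partialM l (cst c) f x (derivable_cst _ _ _) df.
by rewrite partial_cst /= mulr0 addr0.
Qed.

Lemma coordalg_partial f l : coordalg f -> coordalg (partial l f).
Proof.
elim=> [i h sh|c|g h ag dg ah dh|g h ag dg ah dh].
- rewrite partial_coord//; case: (i == l); last exact: coordalg_cst.
  by apply: coordalg_coord; exact: smooth_real_derive1.
- by rewrite partial_cst; exact: coordalg_cst.
- rewrite (_ : partial l _ = partial l g + partial l h); first exact: coordalgD.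
  by apply/funext => x; rewrite partialD//; exact: coordalg_derivable.
- rewrite (_ : partial l _ = g * partial l h + h * partial l g).
    by apply: coordalgD; exact: coordalgM.
  by apply/funext => x; rewrite partialM//; exact: coordalg_derivable.
Qed.

Lemma coordalg_smooth f : coordalg f -> smooth f.
Proof.
move=> af s; have as_ : coordalg (iter_partial s f).
  by elim: s => //= i s; exact: coordalg_partial.
split; first exact: coordalg_continuous.
by move=> i x; exact: coordalg_derivable.
Qed.

Lemma coordalgZ c f : coordalg f -> coordalg (fun x => c * f x).
Proof. by move=> af; exact: (coordalgM (coordalg_cst c) af). Qed.

Lemma coordalg_sum (I : Type) (r : seq I) (F : I -> 'rV[R]_n -> R) :
  (forall i, coordalg (F i)) -> coordalg (fun x => \sum_(i <- r) F i x).
Proof.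
move=> aF; elim: r => [|i r IH].
  by under eq_fun do rewrite big_nil; exact: coordalg_cst.
by under eq_fun do rewrite big_cons; exact: (coordalgD (aF i) IH).
Qed.

Lemma coordalg_prod (I : Type) (r : seq I) (F : I -> 'rV[R]_n -> R) :
  (forall i, coordalg (F i)) -> coordalg (fun x => \prod_(i <- r) F i x).
Proof.
move=> aF; elim: r => [|i r IH].
  by under eq_fun do rewrite big_nil; exact: coordalg_cst.
by under eq_fun do rewrite big_cons; exact: (coordalgM (aF i) IH).
Qed.

Lemma partial_sum (I : Type) (r : seq I) (F : I -> 'rV[R]_n -> R) l x :
  (forall i, coordalg (F i)) ->
  partial l (fun y => \sum_(i <- r) F i y) x = \sum_(i <- r) partial l (F i) x.
Proof.
move=> aF; elim: r => [|i r IH].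
  by under eq_fun do rewrite big_nil; rewrite big_nil (partial_cst l 0).
under eq_fun do rewrite big_cons; rewrite big_cons -IH.
have := @partialD l (F i) (fun y => \sum_(j <- r) F j y) x; apply.
  by apply: coordalg_derivable.
by apply: coordalg_derivable; apply: coordalg_sum.
Qed.

Lemma partial_prod_coord (h : 'I_n -> R -> R) l x :
  derivable (h l) (x ord0 l) 1 ->
  partial l (fun y => \prod_i h i (y ord0 i)) x =
  derive1 (h l) (x ord0 l) * \prod_(i | i != l) h i (x ord0 i).
Proof.
move=> dh; set C := \prod_(i | _) _.
have [] := @is_derive_slice (fun y => \prod_i h i (y ord0 i))
  (C *: h l) l x; last 1 first.
- rewrite derive1E => _; rewrite /partial => ->.
  by rewrite deriveZ// [LHS]mulrC derive1E.
- move=> k; rewrite (bigD1 l)//= [RHS]mulrC; congr (h l _ * _).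
    by have := coord_line l l x k; rewrite eqxx.
  apply: eq_bigr => i /negbTE il; congr (h i _).
  by have := coord_line l i x k; rewrite il.
- exact: derivableZ.
Qed.

End coordinate_algebra.

(** * Integration along lines *)

Section integration_by_parts.
Context {R : realType}.
Notation dx n := (@lebesgue_rV R n).
Notation leb := (@lebesgue_measure R).

Lemma bounded_off_cube_integrable n (G : 'rV[R]_n -> R) (M : R) :
  measurable_fun setT G -> (forall x, `|G x| <= M) ->
  (forall x, ~ unit_cube x -> G x = 0) ->
  (dx n).-integrable setT (EFin \o G).
Proof.
move=> mG GM G0.
have GE : G = G \_ unit_cube.
  apply/funext => x; rewrite patchE; case: ifPn => //; rewrite notin_setE.
  exact: G0.
rewrite GE -restrict_EFin; apply/(integrable_mkcond (EFin \o G) (@measurable_unit_cube R n)).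
apply: measurable_bounded_integrable.
- exact: measurable_unit_cube.
- exact: lebesgue_unit_cube_lty.
- exact: measurable_funS mG.
- exists M; split; first exact: num_real.
  by move=> y My x _ /=; rewrite (le_trans (GM x))// ltW.
Qed.

(** By induction on the dimension, following the recursive definition of the
measure: for the first coordinate integrate it first and use the hypothesis; for
another one, integrate last over the first coordinate, the induction hypothesis
applying to each slice.  Boundedness and vanishing off the cube ensure the
integrability needed by Fubini, and pass to the slices. *)
Lemma integral_lines0 n (i : 'I_n) (G : 'rV[R]_n -> R) (M : R) :
  measurable_fun setT G -> (forall x, `|G x| <= M) ->
  (forall x, ~ unit_cube x -> G x = 0) ->
  (forall x : 'rV[R]_n, x ord0 i = 0 ->
    (\int[leb]_t (G (x + t *: delta_mx ord0 i))%:E = 0)%E) ->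
  (\int[dx n]_x (G x)%:E = 0)%E.
Proof.
elim: n i G => [[]//|n IH] i G mG GM G0 line0.
have IG := bounded_off_cube_integrable mG GM G0.
have mEG : measurable_fun setT (EFin \o G) by exact/measurable_EFinP.
pose GG : R * 'rV[R]_n -> \bar R := (EFin \o G) \o @row_cons R n.
have mGG : measurable_fun setT GG.
  by apply: measurableT_comp; [exact/measurable_EFinP|exact: measurable_row_cons].
have IGG : (leb \x dx n)%E.-integrable setT GG.
  apply/integrableP; split=> //.
  have /integrableP[_] := IG; rewrite /= /lebesgue_step.
  rewrite ge0_integral_pushforward//=; first exact: measurable_row_cons.
  by apply/measurable_EFinP; exact: (measurableT_comp (@normr_measurable R _) mG).
have -> : (\int[dx n.+1]_x (G x)%:E = \int[leb \x dx n]_z GG z)%E.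
  rewrite /= /lebesgue_step integral_pushforward//; exact: measurable_row_cons.
case: (unliftP ord0 i) => [j|] ij; last first.
  rewrite -integral21_prod_meas1//; rewrite /fubini_G; apply: integral0_eq => y _.
  have := line0 (row_cons (0, y)); rewrite ij row_cons0 => /(_ erefl) <-.
  apply: eq_integral => t _; rewrite /GG /=; congr (G _)%:E.
  apply/rowP => k; apply: etrans (esym (coordD_line _ _ _ _)).
  by case: (unliftP ord0 k) => [l|] ->; rewrite ?row_consS ?row_cons0 ?eqxx/= ?addr0 ?add0r.
rewrite -integral12_prod_meas1// /fubini_F; apply: integral0_eq => a _.
rewrite /GG /=; apply: (IH j (fun y => G (row_cons (a, y)))) => //.
- apply: measurableT_comp => //.
  apply: (measurableT_comp (@measurable_row_cons R n)).
  exact: measurable_fun_pair.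
- move=> y ny; apply: G0 => cy; apply: ny => k.
  by have := cy (lift ord0 k); rewrite row_consS.
- move=> y yj; have := line0 (row_cons (a, y)); rewrite ij row_consS => /(_ yj) <-.
  apply: eq_integral => t _; congr (G _)%:E.
  apply/rowP => k; apply: etrans (esym (coordD_line _ _ _ _)).
  case: (unliftP ord0 k) => [l|] ->; last by rewrite !row_cons0 addr0.
  rewrite !row_consS (inj_eq lift_inj); exact: coordD_line.
Qed.

Lemma integral_line_partial0 n (i : 'I_n) (psi : 'rV[R]_n -> R) (x : 'rV[R]_n) :
  (forall y, derivable psi y (delta_mx ord0 i)) -> continuous (partial i psi) ->
  (forall y, ~ unit_cube y -> psi y = 0) ->
  (forall y, ~ unit_cube y -> partial i psi y = 0) ->
  x ord0 i = 0 ->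
  (\int[leb]_t (partial i psi (x + t *: delta_mx ord0 i))%:E = 0)%E.
Proof.
move=> dpsi cpsi psi0 dpsi0 xi.
set g : R -> R := fun t => partial i psi (x + t *: delta_mx ord0 i).
set F : R -> R := fun t => psi (x + t *: delta_mx ord0 i).
have off (t : R) : ~~ (0 < t < 1) -> ~ unit_cube (x + t *: delta_mx ord0 i).
  move=> /negP nt; apply: contra_not nt => /(_ i).
  by have := coordD_line i i x t; rewrite eqxx xi add0r => ->.
have dF (t : R) : is_derive t 1 F (g t) by apply: is_derive_line.
have F01 : F 0 = 0 /\ F 1 = 0.
  by split; apply: psi0; apply: off; rewrite ltxx ?andbF.
have cg : continuous g.
  move=> t; apply: continuous_comp; last exact: cpsi.
  by apply: cvgD; [exact: cvg_cst|apply: cvgZr_tmp; exact: cvg_id].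
have cF : continuous F.
  by apply: derivable_continuous => t; case: (dF t).
have -> : (\int[leb]_t (g t)%:E = \int[leb]_(t in `[0%R, 1%R]) (g t)%:E)%E.
  rewrite [RHS]integral_mkcond; apply: eq_integral => t _.
  rewrite patchE; case: ifPn => //; rewrite notin_setE /= in_itv /= => nt.
  rewrite /g dpsi0//; apply: off; apply/negP => /andP[t0 t1]; apply: nt.
  by rewrite !ltW.
rewrite (@continuous_FTC2 _ g F).
- by rewrite F01.1 F01.2 subee.
- exact: ltr01.
- exact: continuous_subspaceT.
- split; [by move=> t _; case: (dF t)| |].
  + by apply: cvg_at_right_filter; exact: cF.
  + by apply: cvg_at_left_filter; exact: cF.
- by move=> t _; rewrite derive1E; case: (dF t).
Qed.

End integration_by_parts.

(** * Weak derivatives of C^1 functions *)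

Section weak_derivatives.
Context {R : realType} {n : nat}.
Notation dx := (@lebesgue_rV R n).
Implicit Types (f phi G : 'rV[R]_n -> R) (K : set 'rV[R]_n) (i : 'I_n).

Lemma continuous_bounded_on G K : continuous G -> compact K ->
  exists M : R, forall x, K x -> `|G x| <= M.
Proof.
move=> cG cK.
have /compact_bounded[M [_ HM]] : compact (G @` K).
  by apply: continuous_compact cK; exact: continuous_subspaceT.
by exists (M + 1) => x Kx; apply: (HM (M + 1)); [rewrite ltrDl|exists x].
Qed.

Lemma continuous_bounded_cube G : continuous G ->
  exists M : R, forall x, unit_cube x -> `|G x| <= M.
Proof.
move=> cG; have cK : compact [set x : 'rV[R]_n | forall i, `[0, 1]%classic (x ord0 i)].
  apply: (@rV_compact R n (fun _ => `[0, 1]%classic)) => i.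
  exact: segment_compact.
have [M HM] := continuous_bounded_on cG cK.
exists M => x cx; apply: HM => i /=; rewrite in_itv /=.
by have /andP[x0 x1] := cx i; rewrite !ltW.
Qed.

Lemma continuous_L2_cube G : continuous G -> L2 unit_cube G.
Proof.
move=> cG; have [M HM] := continuous_bounded_cube cG.
apply: (L2_bounded (@measurable_unit_cube R n) (lebesgue_unit_cube_lty n) _ HM).
exact: measurable_funS (continuous_measurable_rV cG).
Qed.

Lemma partial_off_support i phi x :
  ~ closure [set y | phi y != 0] x -> partial i phi x = 0.
Proof.
move=> nKx; rewrite /partial (@near_eq_derive _ _ _ phi (cst 0)) ?derive_cst//.
have oK : open (~` closure [set y | phi y != 0]).
  by apply: closed_openC; exact: closed_closure.
have : nbhs x (~` closure [set y | phi y != 0]) by exact: open_nbhs_nbhs.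
apply: filterS => y nKy; apply/eqP/negPn/negP => y0; apply: nKy.
exact: subset_closure.
Qed.

(** The product f * phi has compact support in the cube, so that its derivative
f * partial i phi + phi * partial i f has zero integral along every line in
direction i, and thus zero integral. *)
Lemma weak_partial_C1 i f :
  (forall x, derivable f x (delta_mx ord0 i)) ->
  continuous f -> continuous (partial i f) ->
  weak_partial unit_cube i f (partial i f).
Proof.
move=> df cf cdf phi [sphi cK sub].
set K := closure _ in cK sub.
have [cphi dphi'] := sphi [::]; have dphi x := dphi' i x.
have [cdphi _] := sphi [:: i]; rewrite /= in cphi dphi cdphi.
have phi0 x : ~ K x -> phi x = 0.
  by move=> nK; apply/eqP/negPn/negP => h; apply: nK; exact: subset_closure.
have dphi0 x : ~ K x -> partial i phi x = 0 by exact: partial_off_support.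
have mcube := @measurable_unit_cube R n.
have L2c (g : 'rV[R]_n -> R) : continuous g -> L2 unit_cube g by exact: continuous_L2_cube.
set G := f * partial i phi + phi * partial i f.
have GE : partial i (f * phi) = G.
  by apply/funext => x; rewrite partialM.
have G0 x : ~ K x -> G x = 0.
  by move=> nK; rewrite /G !fctE dphi0// phi0// mulr0 mul0r addr0.
have cG : continuous G.
  move=> x; apply: continuousD; apply: continuousM.
  - exact: cf.
  - exact: cdphi.
  - exact: cphi.
  - exact: cdf.
have [M HM] := continuous_bounded_on cG cK.
have M0 : (\int[dx]_x (G x)%:E = 0)%E.
  apply: (@integral_lines0 _ _ i _ `|M|).
  - exact: continuous_measurable_rV.
  - move=> x; have [/HM|/G0 ->] := pselect (K x); last by rewrite normr0.
    by move=> /le_trans; apply; exact: ler_norm.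
  - by move=> x nx; apply: G0 => /sub.
  - move=> x xi; rewrite -GE; apply: integral_line_partial0; last exact: xi.
    + by move=> y; exact (derivableM (df y) (dphi y)).
    + by rewrite GE.
    + by move=> y ny; rewrite fctE phi0 ?mulr0// => /sub.
    + by move=> y ny; rewrite GE G0// => /sub.
have : \int[dx]_(x in unit_cube) G x = 0.
  rewrite /Rintegral integral_mkcond (_ : _ \_ _ = EFin \o G) ?M0//.
  apply/funext => x; rewrite patchE; case: ifPn => //; rewrite notin_setE => nx.
  by rewrite /= G0// => /sub.
rewrite RintegralD//; try by apply: L2dot_integrable => //; exact: L2c.
move/eqP; rewrite addr_eq0 => /eqP; rewrite /L2dot => ->; congr (- _).
by apply: eq_Rintegral => x _; rewrite mulrC.
Qed.

Lemma coordalg_L2 f : coordalg f -> L2 unit_cube f.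
Proof. by move=> /coordalg_continuous; exact: continuous_L2_cube. Qed.

End weak_derivatives.

(** * The H^1 norm, and cutoffs of the unit interval *)

Section sobolev_norm.
Context {R : realType} {n : nat}.
Implicit Types (D : set 'rV[R]_n) (w : @sobolev_pair R n).

(** For such pairs the extended real [H1norm] is the image of a real square root,
which is monotone and continuous. *)
Definition finite_components D w :=
  (L2norm D w.1 < +oo)%E /\ forall i, (L2norm D (w.2 i) < +oo)%E.

Lemma H1normE D w : finite_components D w ->
  H1norm D w = (Num.sqrt (fine (L2norm D w.1) ^+ 2 +
    \sum_(i < n) fine (L2norm D (w.2 i)) ^+ 2))%:E.
Proof.
move=> [fin1 fin2]; have fK f : (L2norm D f < +oo)%E ->
    (L2norm D f ^+ 2 = (fine (L2norm D f) ^+ 2)%:E)%E.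
  by move=> ffin; rewrite EFin_expe fineK// ge0_fin_numE ?L2norm_ge0.
rewrite /H1norm fK//; under eq_bigr do rewrite fK//.
rewrite sumEFin -EFinD poweR_EFin powR12_sqrt// addr_ge0 ?sqr_ge0//.
by apply: sumr_ge0 => i _; exact: sqr_ge0.
Qed.

Lemma le_L2norm_H1norm D w : finite_components D w ->
  (L2norm D w.1 <= H1norm D w)%E /\
  forall i, (L2norm D (w.2 i) <= H1norm D w)%E.
Proof.
move=> fw; rewrite H1normE//; have [fin1 fin2] := fw.
have le f (a : R) : (L2norm D f < +oo)%E -> fine (L2norm D f) ^+ 2 <= a ->
    (L2norm D f <= (Num.sqrt a)%:E)%E.
  move=> ffin fa; rewrite -[leLHS]fineK; last by rewrite ge0_fin_numE ?L2norm_ge0.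
  rewrite lee_fin -[leLHS]ger0_norm ?fine_ge0 ?L2norm_ge0// -sqrtr_sqr.
  exact: ler_wsqrtr.
split=> [|i]; apply: le => //.
  by rewrite lerDl; apply: sumr_ge0 => i _; exact: sqr_ge0.
rewrite (bigD1 i)//= addrCA lerDl addr_ge0 ?sqr_ge0//.
by apply: sumr_ge0 => j _; exact: sqr_ge0.
Qed.

Lemma H1norm_cvg0 D (w_ : nat -> @sobolev_pair R n) :
  (forall k, finite_components D (w_ k)) ->
  L2norm D (w_ k).1 @[k --> \oo] --> 0%E ->
  (forall i, L2norm D ((w_ k).2 i) @[k --> \oo] --> 0%E) ->
  H1norm D (w_ k) @[k --> \oo] --> 0%E.
Proof.
move=> fw c1 c2.
under eq_fun do rewrite H1normE//.
apply/cvg_EFin; first exact: nearW.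
rewrite -[X in _ --> X]sqrtr0; apply: continuous_cvg; first exact: sqrt_continuous.
rewrite [X in _ --> X](_ : 0 = 0 ^+ 2 + \sum_(i < n) 0 ^+ 2); last first.
  by rewrite expr0n /= big1 ?addr0// => i _; rewrite expr0n.
have sq (u : nat -> \bar R) : u k @[k --> \oo] --> 0%E ->
    fine (u k) ^+ 2 @[k --> \oo] --> (0 ^+ 2 : R).
  by move=> /fine_cvg u0; rewrite expr2; apply: cvgM.
apply: cvgD; first exact: sq.
by apply: cvg_big => [|i _]; [exact: add_continuous|exact: (sq _ (c2 i))].
Qed.

End sobolev_norm.

Section cutoff.
Context {R : realType}.
Implicit Types (t : R) (k : nat).

(** A smooth step: zero for t <= 1/k, and close to 1 as soon as k t is large. *)
Definition edge k t : R := flat 1 (k%:R * t - 1).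

Let flat_X2 : ((1 - 1^`()) * 'X^2 : {poly R}) = 'X^2.
Proof. by rewrite -[X in X^`()]polyC1 derivC subr0 mul1r. Qed.

Lemma is_derive_edge k t : is_derive t 1 (edge k) (k%:R * flat 'X^2 (k%:R * t - 1)).
Proof.
have [d e] := is_derive_flat 1 (k%:R * t - 1).
have := is_derive_affine d; rewrite derive1E e flat_X2; exact.
Qed.

Lemma edge_itv k t : 0 <= edge k t <= 1.
Proof.
rewrite /edge /flat; case: ifP => [p|_]; last by rewrite lexx ler01.
rewrite hornerC mul1r expR_ge0 /= expR_le1 oppr_le0 invr_ge0; exact: ltW.
Qed.

Lemma edge_eq0 k t : k%:R * t <= 1 -> edge k t = 0.
Proof. by move=> kt; rewrite /edge /flat ifF// ltNge subr_le0 kt. Qed.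

Lemma flatX2_ge0 (y : R) : 0 <= flat 'X^2 y.
Proof.
by rewrite /flat; case: ifP => // _; rewrite hornerXn mulr_ge0 ?sqr_ge0 ?expR_ge0.
Qed.

(** With y = k t - 1 and z = 1/y, this is (y + 1) z^2 exp(-z) = (z + z^2) exp(-z),
and z <= exp z, z^2 <= 2 exp z.  The bound is uniform in k: it says that the
derivative of the step is at most 3/t, which is what a function that is O(t) at
the edge can absorb. *)
Lemma derive1_edge_bound k t :
  0 <= t -> `|t * (k%:R * flat 'X^2 (k%:R * t - 1))| <= 3.
Proof.
move=> t0; rewrite ger0_norm; last first.
  by rewrite !mulr_ge0// flatX2_ge0.
rewrite mulrA [t * _]mulrC; set y := k%:R * t - 1.
have -> : k%:R * t = y + 1 by rewrite /y subrK.
rewrite /flat; case: ifP => [y0|_]; last by rewrite mulr0.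
rewrite hornerXn; set z := y^-1.
have z0 : 0 <= z by rewrite invr_ge0 ltW.
have -> : (y + 1) * (z ^+ 2 * expR (- z)) = (z + z ^+ 2) * expR (- z).
  by rewrite /z; field; rewrite gt_eqF.
rewrite expRN ler_pdivrMr ?expR_gt0//.
have h1 := exprn_expR_bound 1 z0; have h2 := exprn_expR_bound 2 z0.
rewrite expr1 (_ : 1`! = 1)%N// mul1r in h1; rewrite (_ : 2`! = 2)%N// in h2.
lra.
Qed.

Let cvg_arg t : 0 < t -> (k%:R * t - 1)^-1 @[k --> \oo] --> (0 : R).
Proof.
move=> t0; apply/gtr0_cvgV0.
  near=> k; rewrite subr_gt0 -ltr_pdivrMr//; near: k; exact: nbhs_infty_gtr.
apply/cvgryPge => A; near=> k.
rewrite lerBrDr -ler_pdivrMr//; near: k; exact: nbhs_infty_ger.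
Unshelve. all: by end_near. Qed.

Lemma edge_cvg t : 0 < t -> edge k t @[k --> \oo] --> (1 : R).
Proof.
move=> t0; have h : expR (- (k%:R * t - 1)^-1) @[k --> \oo] --> (1 : R).
  rewrite [X in _ --> X](_ : 1 = expR (- 0)); last by rewrite oppr0 expR0.
  apply: continuous_cvg.
    exact: continuous_expR.
  by apply: cvgN; exact: cvg_arg.
apply: cvg_trans h; apply: near_eq_cvg; near=> k.
rewrite /edge /flat ifT ?hornerC ?mul1r// subr_gt0 -ltr_pdivrMr//.
by near: k; exact: nbhs_infty_gtr.
Unshelve. all: by end_near. Qed.

Lemma derive1_edge_cvg t :
  0 < t -> k%:R * flat 'X^2 (k%:R * t - 1) @[k --> \oo] --> (0 : R).
Proof.
move=> t0; have c := cvg_arg t0.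
have h : (((k%:R * t - 1)^-1 + 1) * (k%:R * t - 1)^-1) / t @[k --> \oo] --> (0 : R).
  rewrite -[X in _ --> X](mul0r t^-1); apply: cvgMl.
  rewrite -[X in _ --> X](mulr0 (0 + 1)); apply: cvgM => //.
  by apply: cvgD => //; exact: cvg_cst.
apply: (@squeeze_cvgr _ _ _ _ (cst 0)
  (fun k => (((k%:R * t - 1)^-1 + 1) * (k%:R * t - 1)^-1) / t)) => //;
  last exact: cvg_cst.
near=> k; rewrite mulr_ge0 ?flatX2_ge0//=.
have y0 : 0 < k%:R * t - 1.
  by rewrite subr_gt0 -ltr_pdivrMr//; near: k; exact: nbhs_infty_gtr.
rewrite ler_pdivlMr// mulrAC; set y := k%:R * t - 1 in y0 *.
have -> : k%:R * t = y + 1 by rewrite /y subrK.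
rewrite /flat y0 hornerXn.
have -> : (y + 1) * (y^-1 ^+ 2 * expR (- y^-1)) = (y^-1 + 1) * y^-1 * expR (- y^-1).
  by field; rewrite gt_eqF.
rewrite ler_piMr ?mulr_ge0 ?addr_ge0 ?invr_ge0 ?(ltW y0)//.
by rewrite expR_le1 oppr_le0 invr_ge0 ltW.
Unshelve. all: by end_near. Qed.

Definition cutoff k t : R := edge k t * edge k (1 - t).

Definition dcutoff k t : R :=
  edge k (1 - t) * (k%:R * flat 'X^2 (k%:R * t - 1)) -
  edge k t * (k%:R * flat 'X^2 (k%:R * (1 - t) - 1)).

Lemma is_derive_cutoff k t : is_derive t 1 (cutoff k) (dcutoff k t).
Proof.
have dl : is_derive t 1 (fun s : R => 1 - s) (- 1).
  by rewrite -[- 1]add0r; apply: is_deriveB.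
have d2 := @is_derive1_comp _ (edge k) (fun s => 1 - s) t _ _
  (is_derive_edge k (1 - t)) dl.
apply: (is_derive_eq (is_deriveM (is_derive_edge k t) d2)).
rewrite /dcutoff /GRing.scale /=; ring.
Qed.

End cutoff.

(** * Functions vanishing on the boundary belong to H^1_0 *)

Section zero_trace.
Context {R : realType} {n : nat}.
Notation dx := (@lebesgue_rV R n).
Notation cube := (@unit_cube R n).
Implicit Types (f : 'rV[R]_n -> R) (x : 'rV[R]_n) (k : nat) (i : 'I_n).

Lemma cutoff_itv k (t : R) : 0 <= cutoff k t <= 1.
Proof.
rewrite /cutoff; have /andP[a0 a1] := edge_itv k t.
have /andP[b0 b1] := edge_itv k (1 - t).
by rewrite mulr_ge0//= mulr_ile1.
Qed.

(** The two terms of the derivative of the cutoff are concentrated near t = 0 and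
t = 1; each is balanced by the bound on a at the corresponding end. *)
Lemma dcutoff_bound k (t a C : R) : 0 <= t <= 1 -> `|a| <= C * t ->
  `|a| <= C * (1 - t) -> `|a * dcutoff k t| <= 6 * C.
Proof.
move=> /andP[t0 t1] a0 a1.
have t0' : 0 <= 1 - t by rewrite subr_ge0.
have C0 : 0 <= C.
  by have := normr_ge0 a; have : C = C * t + C * (1 - t); [ring|lra].
have aux (s : R) : 0 <= s -> `|a| <= C * s ->
    `|a * (k%:R * flat 'X^2 (k%:R * s - 1))| <= 3 * C.
  move=> s0 as_; have := derive1_edge_bound k s0.
  rewrite !normrM (ger0_norm s0); set q := `|k%:R| * _ => sq.
  apply: (@le_trans _ _ ((C * s) * q)).
    by rewrite ler_wpM2r// mulr_ge0.
  by rewrite -mulrA mulrC ler_wpM2r.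
rewrite /dcutoff mulrBr (le_trans (ler_normB _ _))//.
have -> : 6 * C = 3 * C + 3 * C by ring.
have /andP[e0 e1] := edge_itv k t; have /andP[g0 g1] := edge_itv k (1 - t).
apply: lerD; rewrite mulrCA normrM ger0_norm//.
  exact: le_trans (ler_piMl (normr_ge0 _) g1) (aux _ t0 a0).
exact: le_trans (ler_piMl (normr_ge0 _) e1) (aux _ t0' a1).
Qed.

Lemma cutoff_cvg (t : R) : 0 < t < 1 -> cutoff k t @[k --> \oo] --> (1 : R).
Proof.
move=> /andP[t0 t1]; rewrite -[X in _ --> X](mulr1 1).
by apply: cvgM; apply: edge_cvg => //; rewrite subr_gt0.
Qed.

Lemma dcutoff_cvg (t : R) : 0 < t < 1 -> dcutoff k t @[k --> \oo] --> (0 : R).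
Proof.
move=> /andP[t0 t1]; have t1' : 0 < 1 - t by rewrite subr_gt0.
rewrite -[X in _ --> X](subr0 0) -[X in X - _](mulr0 1) -[X in _ - X](mulr0 1).
by apply: cvgB; apply: cvgM; by [apply: edge_cvg | apply: derive1_edge_cvg].
Qed.

Definition cube_cutoff k x : R := \prod_i cutoff k (x ord0 i).

Lemma cube_cutoff_itv k x : 0 <= cube_cutoff k x <= 1.
Proof.
rewrite /cube_cutoff; elim/big_ind : _ => [|a b /andP[a0 a1] /andP[b0 b1]|i _].
- by rewrite ler01 lexx.
- by rewrite mulr_ge0//= mulr_ile1.
- exact: cutoff_itv.
Qed.

Lemma cube_cutoff_cvg x : cube x -> cube_cutoff k x @[k --> \oo] --> (1 : R).
Proof.
move=> cx; rewrite [X in _ --> X](_ : 1 = \prod_(i < n) 1); last by rewrite big1.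
apply: cvg_big => [|i _]; first exact: mul_continuous.
exact: cutoff_cvg.
Qed.

Lemma coordalg_cube_cutoff k : coordalg (cube_cutoff k).
Proof.
have se : smooth_real (edge k : R -> R).
  have -> : edge k = (fun t : R => flat 1 (k%:R * t + (- 1))) by [].
  apply: smooth_real_affine.
  exact: smooth_real_flat.
apply: coordalg_prod => i; apply: (coordalgM
  (f := fun x => edge k (x ord0 i)) (g := fun x => edge k (1 - x ord0 i))).
  exact: (coordalg_coord i se).
apply: (coordalg_coord i (h := fun t => edge k (1 - t))).
have -> : (fun t : R => edge k (1 - t)) = (fun t => edge k (- 1 * t + 1)).
  by apply/funext => t; rewrite mulN1r addrC.
exact: smooth_real_affine.
Qed.

Lemma partial_cube_cutoff k i x : partial i (cube_cutoff k) x =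
  dcutoff k (x ord0 i) * \prod_(j | j != i) cutoff k (x ord0 j).
Proof.
have [d e] := is_derive_cutoff k (x ord0 i).
by rewrite [LHS](@partial_prod_coord _ _ (fun _ => cutoff k))// derive1E e.
Qed.

(** The cutoff vanishes unless 1/(k+1) <= x_i <= 1 - 1/(k+1) for all i, which
defines a compact subset of the open cube. *)
Lemma test_function_cutoff k f :
  coordalg f -> test_function cube (fun x => f x * cube_cutoff k.+1 x).
Proof.
move=> af; set phi := fun _ => _.
have k0 : 0 < k.+1%:R :> R by rewrite ltr0n.
pose K := [set x : 'rV[R]_n | forall i, `[k.+1%:R^-1, 1 - k.+1%:R^-1]%classic (x ord0 i)].
have cK : compact K.
  apply: (@rV_compact R n (fun _ => `[k.+1%:R^-1, 1 - k.+1%:R^-1]%classic)) => i.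
  exact: segment_compact.
have closedK : closed K by apply: compact_closed => //; exact: norm_hausdorff.
have sub : closure [set x | phi x != 0] `<=` K.
  rewrite [X in _ `<=` X]((closure_id K).1 closedK); apply: closureS => x /= phix i /=.
  have : cutoff k.+1 (x ord0 i) != 0.
    apply: contraNneq phix => c0.
    by rewrite /phi /cube_cutoff (bigD1 i)//= c0 mul0r mulr0.
  rewrite /cutoff mulf_eq0 negb_or => /andP[e0 e1].
  have pos (t : R) : edge k.+1 t != 0 -> k.+1%:R^-1 <= t.
    move=> et; rewrite leNgt; apply: contra et => /ltW tk; apply/eqP/edge_eq0.
    by rewrite mulrC -ler_pdivlMr// div1r.
  by rewrite in_itv /= pos//= lerBrDr addrC -lerBrDr; exact: pos.
split.
- by apply: coordalg_smooth; exact: (coordalgM af (coordalg_cube_cutoff _)).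
- exact: subclosed_compact (@closed_closure _ _) cK sub.
- move=> x /sub Kx i; have := Kx i; rewrite /= in_itv /= => /andP[h1 h2].
  have i0 : 0 < k.+1%:R^-1 :> R by rewrite invr_gt0.
  by rewrite (lt_le_trans i0 h1) (le_lt_trans h2)// ltrBlDr ltrDl.
Qed.

(** Quantitative form of the Dirichlet condition: f is bounded by a multiple of
the distance to each of the faces of the cube. *)
Definition vanishing_on_boundary f := exists C : R, forall x, cube x ->
  forall i, `|f x| <= C * x ord0 i /\ `|f x| <= C * (1 - x ord0 i).

Lemma vanishing_sum (I : Type) (r : seq I) (F : I -> 'rV[R]_n -> R) :
  (forall p, vanishing_on_boundary (F p)) ->
  vanishing_on_boundary (fun x => \sum_(p <- r) F p x).
Proof.
move=> vF; elim: r => [|p r [C HC]].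
  by exists 0 => x _ i; rewrite big_nil normr0 !mul0r.
have [C' HC'] := vF p; exists (C' + C) => x cx i; rewrite big_cons.
have [a1 a2] := HC x cx i; have [b1 b2] := HC' x cx i.
by rewrite !mulrDl; split; apply: (le_trans (ler_normD _ _)); exact: lerD.
Qed.

Lemma vanishingZ (a : R) (f : 'rV[R]_n -> R) : vanishing_on_boundary f ->
  vanishing_on_boundary (fun x => a * f x).
Proof.
move=> [C HC]; exists (`|a| * C) => x cx i; have [h1 h2] := HC x cx i.
by rewrite normrM -!mulrA !ler_wpM2l.
Qed.

Lemma finite_components_L2 (w : @sobolev_pair R n) :
  L2 cube w.1 -> (forall i, L2 cube (w.2 i)) -> finite_components cube w.
Proof. by move=> [_ f1] f2; split=> // i; have [] := f2 i. Qed.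

Lemma H1_with_gradient f : coordalg f -> H1 cube (with_gradient f).
Proof.
move=> af; split=> [|i]; first exact: coordalg_L2.
split; first exact/coordalg_L2/coordalg_partial.
apply: weak_partial_C1.
- by move=> x; exact: coordalg_derivable.
- exact: coordalg_continuous.
- exact/coordalg_continuous/coordalg_partial.
Qed.

(** The approximations f * cube_cutoff converge to f and their gradients to the
gradient of f at every point of the cube.  They are uniformly bounded: in the
gradient the dangerous term is f times the derivative of the cutoff, which
[dcutoff_bound] controls by the vanishing of f at the boundary.  So both
convergences hold in L^2 by domination. *)
Lemma H10_with_gradient f : coordalg f -> vanishing_on_boundary f ->
  H10 cube (with_gradient f).
Proof.
move=> af [C HC]; split; first exact: H1_with_gradient.
exists (fun k x => f x * cube_cutoff k.+1 x); split=> [k|].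
  exact: test_function_cutoff.
have mcube := @measurable_unit_cube R n.
have fcube := @lebesgue_unit_cube_lty R n.
set g := fun k x => f x * cube_cutoff k.+1 x.
have ag k : coordalg (g k) by exact: (coordalgM af (coordalg_cube_cutoff _)).
have aL := @coordalg_L2 R n.
have am h : coordalg h -> measurable_fun cube h by move=> /aL[].
have [M HM] := continuous_bounded_cube (coordalg_continuous af).
have S (u : nat -> R) (l : R) : u k @[k --> \oo] --> l -> u k.+1 @[k --> \oo] --> l.
  by move=> ul; rewrite (cvg_shiftS u).
apply: H1norm_cvg0.
- move=> k; apply: finite_components_L2.
    exact: (L2B mcube (aL _ af) (aL _ (ag k))).
  move=> i; exact: (L2B mcube (aL _ (coordalg_partial i af))
    (aL _ (coordalg_partial i (ag k)))).
- apply: (@L2norm_cvg0 _ _ _ _ _ _ M) => //.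
  + by move=> k; exact: measurable_funB (am _ af) (am _ (ag k)).
  + move=> k x cx; rewrite /= !fctE -[X in X - _]mulr1 -mulrBr normrM.
    have /andP[c0 c1] := cube_cutoff_itv k.+1 x.
    rewrite (le_trans _ (HM x cx))// ler_piMr// ger0_norm ?subr_ge0//.
    by rewrite lerBlDr lerDl.
  + move=> x cx; rewrite /= -[X in _ --> X](subrr (f x)).
    apply: cvgB; first exact: cvg_cst.
    rewrite -[X in _ --> X]mulr1; apply: cvgM; first exact: cvg_cst.
    exact: (S _ _ (cube_cutoff_cvg cx)).
- move=> i; have adf := coordalg_partial i af.
  have [M' HM'] := continuous_bounded_cube (coordalg_continuous adf).
  have pg k x : partial i (g k) x = f x * partial i (cube_cutoff k.+1) x +
      cube_cutoff k.+1 x * partial i f x.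
    by apply: partialM; apply: coordalg_derivable => //; exact: coordalg_cube_cutoff.
  have Eg k x : (partial i f - partial i (g k)) x =
      partial i f x * (1 - cube_cutoff k.+1 x) -
      f x * dcutoff k.+1 (x ord0 i) * \prod_(j | j != i) cutoff k.+1 (x ord0 j).
    by rewrite !fctE pg partial_cube_cutoff; ring.
  have cP k x : 0 <= \prod_(j | j != i) cutoff k (x ord0 j) <= 1.
    elim/big_ind : _ => [|a b /andP[a0 a1] /andP[b0 b1]|j _].
    + by rewrite ler01 lexx.
    + by rewrite mulr_ge0//= mulr_ile1.
    + exact: cutoff_itv.
  apply: (@L2norm_cvg0 _ _ _ _ _ _ (M' + 6 * C)) => //.
  + move=> k; apply: measurable_funB (am _ adf) (am _ _).
    exact: (coordalg_partial i (ag k)).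
  + move=> k x cx; rewrite [X in `|X|](Eg k x) (le_trans (ler_normB _ _))//.
    have /andP[c0 c1] := cube_cutoff_itv k.+1 x.
    have /andP[p0 p1] := cP k.+1 x.
    apply: lerD; rewrite normrM.
      rewrite (le_trans _ (HM' x cx))// ler_piMr// ger0_norm ?subr_ge0//.
      by rewrite lerBlDr lerDl.
    rewrite (ger0_norm p0).
    have [h0 h1] := HC x cx i.
    apply: le_trans (@dcutoff_bound k.+1 (x ord0 i) (f x) C _ h0 h1).
      by rewrite ler_piMr.
    by have /andP[x0 x1] := cx i; rewrite !ltW.
  + move=> x cx.
    suff h : partial i f x * (1 - cube_cutoff k.+1 x) -
        f x * dcutoff k.+1 (x ord0 i) * \prod_(j | j != i) cutoff k.+1 (x ord0 j)
        @[k --> \oo] --> (0 : R).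
      by apply: cvg_trans h; apply: near_eq_cvg; apply: nearW => k; rewrite -Eg.
    rewrite -[X in _ --> X](subrr 0); apply: cvgB.
      rewrite -[X in _ --> X](mulr0 (partial i f x)) -[X in _ * X](subrr 1).
      apply: cvgM; first exact: cvg_cst.
      apply: cvgB; first exact: cvg_cst.
      exact: (S _ _ (cube_cutoff_cvg cx)).
    rewrite -[X in _ --> X](mul0r (\prod_(j < n | j != i) 1)).
    apply: cvgM.
      rewrite -[X in _ --> X](mulr0 (f x)).
      apply: cvgM; first exact: cvg_cst.
      exact: (S _ _ (dcutoff_cvg (cx i))).
    apply: cvg_big => [|j _]; first exact: mul_continuous.
    exact: (S _ _ (cutoff_cvg (cx j))).
Qed.

End zero_trace.

(** * Bochner measurability of separated curves, and the dual norm *)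

Section separated_curves.
Import HBSimple.
Context {R : realType}.
Notation dt := (@lebesgue_measure R).

(** A real measurable function g is a pointwise limit of simple functions h_k, and
sc (h_k t) are then simple curves approximating sc (g t).  The norm of the
difference sc a - sc b is a separate hypothesis, because in the application to
H^{-1} the map sc is only linear after restriction to H^1_0: L2dot against an
arbitrary function need not be linear. *)
Lemma bochner_L2_separated (E : zmodType) (V : set E) (N : E -> \bar R)
    (sc : R -> E) (c : R) (g : R -> R) (B T : R) :
  (forall a, V (sc a)) ->
  (forall a, N (sc a) = (`|a| * c)%:E) ->
  (forall a b, N (sc a - sc b) = (`|a - b| * c)%:E) ->
  measurable_fun setT g -> (forall t, t \in `]0, T[ -> `|g t| <= B) ->
  bochner_L2 T V N (fun t => sc (g t)).
Proof.
move=> HV HN HB mg gB; split.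
- by apply: aeW => t _; exact: HV.
- have [h hg] := approximation_sfun measurableT
    ((measurable_EFinP setT g).2 mg).
  exists (fun k (t : R) => sc (h k t)); split=> [k|].
    split.
    + apply: (@sub_finite_set _ _ (sc @` range (h k))).
        by move=> _ [t _ <-]; exists (h k t) => //; exists t.
      by apply: finite_image; exact: fimfunP.
    + move=> e; rewrite (_ : _ @^-1` _ =
          h k @^-1` ([set a | sc a = e] `&` range (h k))).
        (* The preimage of e under sc may be wild, but only finitely many values of h k
           matter. *)
        apply: measurable_funPTI.
        apply: countable_measurable; first exact: measurable_set1.
        apply: finite_set_countable; apply: sub_finite_set (@fimfunP _ _ (h k)).
        exact: subIsetr.
      by apply/seteqP; split=> t /=; [move=> ?; split=> //; exists t|case].
    + by move=> _ [t _ <-]; exact: HV.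
  apply: aeW => t _; under eq_fun do rewrite HB.
  apply/cvg_EFin; first exact: nearW.
  have /fine_cvgP[_ ht] := hg t I.
  rewrite /= -[X in _ --> X](mul0r c); apply: cvgMl.
  rewrite -[X in _ --> X](@normr0 _ R); apply: cvg_norm.
  rewrite -[X in _ --> X](subrr (g t)); apply: cvgB => //; exact: cvg_cst.
- under eq_integral do rewrite HN.
  have [T0|T0] := ltP 0 T; last first.
    by rewrite set_itv_ge ?integral_set0// bnd_simp -leNgt.
  apply: (@le_lt_trans _ _ (\int[dt]_(t in `]0%R, T[) (cst ((B * c) ^+ 2)%:E t))%E).
    apply: ge0_le_integral => //.
    + by move=> t _; rewrite -EFin_expe lee_fin sqr_ge0.
    + apply/(measurable_EFinP _ (fun t => (`|g t| * c) ^+ 2)).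
      apply: measurable_funX; apply: measurable_funM => //.
      by apply: measurableT_comp => //; exact: measurable_funS mg.
    + move=> t /gB gtB; rewrite /= lee_fin -expr2 !exprMn.
      apply: ler_wpM2r; first exact: sqr_ge0.
      by rewrite ler_sqr ?nnegrE// (le_trans _ gtB).
  rewrite integral_cst//= lebesgue_measure_itv /= lte_fin T0.
  by rewrite -EFinB -EFinM ltry.
Qed.

End separated_curves.

Section heat_eigenfunction.
Context {R : realType} {n : nat}.
Notation dt := (@lebesgue_measure R).
Notation cube := (@unit_cube R n).
Implicit Types (f : 'rV[R]_n -> R).

Let mcube := @measurable_unit_cube R n.

Let H10_L2 w : H10 cube w -> L2 cube w.1.
Proof. by case=> -[]. Qed.

Lemma H10_finite_components w : H10 cube w -> finite_components cube w.
Proof.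
by move=> [[Lw Lw2] _]; apply: finite_components_L2 => // i; have [] := Lw2 i.
Qed.

Lemma Hm1norm_le f w : L2 cube f -> H10 cube w -> (H1norm cube w <= 1)%E ->
  (`|L2dot cube f w.1|%:E <= L2norm cube f)%E.
Proof.
move=> Lf Hw w1; apply: le_trans (L2dot_CauchySchwarz mcube Lf (H10_L2 Hw)) _.
rewrite -[leRHS]mule1; apply: lee_wpmul2l; first exact: L2norm_ge0.
by apply: le_trans w1; have [] := le_L2norm_H1norm (H10_finite_components Hw).
Qed.

Lemma H10_0 : H10 cube (with_gradient (cst 0)).
Proof.
apply: H10_with_gradient; first exact: coordalg_cst.
exists 0 => x cx i; rewrite normr0 mul0r mul0r; split=> //.
Qed.

Lemma H1norm0 : H1norm cube (with_gradient (cst 0)) = 0%E.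
Proof.
have n0 i : L2norm cube ((with_gradient (cst 0)).2 i) = 0%E.
  by rewrite /= (partial_cst i 0); exact: L2norm_cst0.
rewrite H1normE; last exact: H10_finite_components H10_0.
rewrite (L2norm_cst0 _) /= expr0n add0r big1 ?sqrtr0// => i _.
by rewrite n0 /= expr0n.
Qed.

Lemma Hm1norm_lty f : L2 cube f -> (Hm1norm cube (L2_Hm1 cube f) < +oo)%E.
Proof.
move=> Lf; apply: le_lt_trans Lf.2; apply: ub_ereal_sup => _ [w [Hw w1] <-].
exact: Hm1norm_le.
Qed.

Lemma L2_Hm1_Hm1 f : L2 cube f -> Hm1 cube (L2_Hm1 cube f).
Proof.
move=> Lf; split; last exact: Hm1norm_lty.
move=> a v w /H10_L2 Lv /H10_L2 Lw; rewrite /L2_Hm1.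
rewrite -L2dotZr// -L2dotDr//; exact: L2Z.
Qed.

(** The inequality <= is immediate; for a != 0 the converse one is the same
inequality applied to the factor 1/a. *)
Lemma Hm1normZ (a : R) (l l' : ('rV[R]_n -> R) -> R) :
  (forall w, H10 cube w -> l' w.1 = a * l w.1) ->
  (Hm1norm cube l < +oo)%E ->
  Hm1norm cube l' = (`|a| * fine (Hm1norm cube l))%:E.
Proof.
move=> ll lfin.
have le b (k k' : ('rV[R]_n -> R) -> R) : (forall w, H10 cube w -> k' w.1 = b * k w.1) ->
    (Hm1norm cube k' <= `|b|%:E * Hm1norm cube k)%E.
  move=> kk; apply: ub_ereal_sup => _ [w [Hw w1] <-].
  rewrite kk// normrM EFinM; apply: lee_wpmul2l => //.
  by apply: ereal_sup_ubound; exists w.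
have ge0 (k : ('rV[R]_n -> R) -> R) : (0 <= Hm1norm cube k)%E.
  apply: le_trans (abse_ge0 (k (cst 0))%:E) _; apply: ereal_sup_ubound.
  exists (with_gradient (cst 0)) => //; split; first exact: H10_0.
  by rewrite /= H1norm0.
have l'fin : (Hm1norm cube l' < +oo)%E.
  by apply: le_lt_trans (le a l l' ll) _; rewrite lte_mul_pinfty.
have lE := fineK (fin_real (introT andP (conj (lt_le_trans (ltNyr 0) (ge0 l)) lfin))).
have l'E := fineK (fin_real (introT andP (conj (lt_le_trans (ltNyr 0) (ge0 l')) l'fin))).
have := le a l l' ll; rewrite -lE -l'E /= -EFinM lee_fin => le1.
congr _%:E; apply/eqP; rewrite eq_le le1 /=.
have [->|a0] := eqVneq a 0; first by rewrite normr0 mul0r fine_ge0.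
have := le a^-1 l' l; rewrite -lE -l'E -EFinM lee_fin normfV.
rewrite ler_pdivlMl ?normr_gt0//; apply => w Hw.
by rewrite ll// mulKf.
Qed.

(** For a test function in place of w this is the weak derivative of each partial
derivative of f; both sides are continuous in w for the H^1 norm, and test
functions are dense in H^1_0. *)
Lemma weak_eigen_equation f lam w :
  coordalg f -> (forall x, \sum_(i < n) partial i (partial i f) x = - lam * f x) ->
  H10 cube w ->
  \sum_(i < n) L2dot cube (partial i f) (w.2 i) = lam * L2dot cube f w.1.
Proof.
move=> af eqf Hw; have [[Lw Hw2] [phi [tphi cphi]]] := Hw.
have Lw2 i : L2 cube (w.2 i) by have [] := Hw2 i.
have aL := @coordalg_L2 R n.
have Lphi k : L2 cube (phi k).
  by have [sphi _ _] := tphi k; apply: continuous_L2_cube; exact: (sphi [::]).1.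
have Ldphi k i : L2 cube (partial i (phi k)).
  by have [sphi _ _] := tphi k; apply: continuous_L2_cube; exact: (sphi [:: i]).1.
have fw k : finite_components cube (w - with_gradient (phi k)).
  apply: finite_components_L2; first exact: (L2B mcube Lw (Lphi k)).
  by move=> i; exact: (L2B mcube (Lw2 i) (Ldphi k i)).
have c1 : L2norm cube (fun x => w.1 x - phi k x) @[k --> \oo] --> 0%E.
  apply: (squeeze_cvge _ (cvg_cst 0%E) cphi); apply: nearW => k.
  by rewrite L2norm_ge0; have [] := le_L2norm_H1norm (fw k).
have c2 i : L2norm cube (fun x => w.2 i x - partial i (phi k) x) @[k --> \oo] --> 0%E.
  apply: (squeeze_cvge _ (cvg_cst 0%E) cphi); apply: nearW => k.
  by rewrite L2norm_ge0; have [_] := le_L2norm_H1norm (fw k); exact.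
have green k : \sum_(i < n) L2dot cube (partial i f) (partial i (phi k)) =
    lam * L2dot cube f (phi k).
  have adf i : coordalg (partial i f) by exact: coordalg_partial.
  have addf i : coordalg (partial i (partial i f)) by exact: coordalg_partial.
  transitivity (- \sum_(i < n) L2dot cube (phi k) (partial i (partial i f))).
    rewrite -sumrN; apply: eq_bigr => i _; rewrite [X in - X]L2dotC.
    apply: (@weak_partial_C1 _ _ i (partial i f)) (tphi k).
    - by move=> x; exact: coordalg_derivable.
    - exact: coordalg_continuous.
    - exact: coordalg_continuous.
  have -> : \sum_(i < n) L2dot cube (phi k) (partial i (partial i f)) =
      L2dot cube (phi k) (fun x => \sum_(i < n) partial i (partial i f) x).
    have ext (s : seq 'I_n) : \sum_(i <- s) L2dot cube (phi k) (partial i (partial i f)) =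
      L2dot cube (phi k) (fun x => \sum_(i <- s) partial i (partial i f) x).
      elim: s => [|i s IH].
        rewrite big_nil; under eq_fun do rewrite big_nil.
        by rewrite /L2dot; under eq_Rintegral do rewrite mulr0; rewrite Rintegral_cst// mul0r.
      rewrite big_cons IH -L2dotDr//; [|exact: aL|].
        by under [in RHS]eq_fun do rewrite big_cons.
      by apply: aL; exact: coordalg_sum.
    exact: ext.
  under [in LHS]eq_fun do rewrite eqf.
  by rewrite L2dotZr ?mulNr ?opprK 1?L2dotC//; exact: aL.
have lim1 : \sum_(i < n) L2dot cube (partial i f) (partial i (phi k)) @[k --> \oo]
    --> \sum_(i < n) L2dot cube (partial i f) (w.2 i).
  apply: cvg_big => [|i _]; first exact: add_continuous.
  by apply: L2dot_cvg => //; exact/aL/coordalg_partial.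
have lim2 : lam * L2dot cube f (phi k) @[k --> \oo] --> lam * L2dot cube f w.1.
  by apply: cvgMr; apply: L2dot_cvg => //; exact: aL.
apply: (cvg_unique _ lim1); first exact: norm_hausdorff.
by apply: cvg_trans lim2; apply: near_eq_cvg; apply: nearW => k; rewrite green.
Qed.

End heat_eigenfunction.

(** * Eigenfunctions give solutions of the heat equation *)

Section heat_eigenmode.
Context {R : realType} {n : nat}.
Notation dt := (@lebesgue_measure R).
Notation cube := (@unit_cube R n).
Implicit Types (f : 'rV[R]_n -> R).

Let mcube := @measurable_unit_cube R n.

Lemma H1norm_with_gradientZ f (a : R) : coordalg f ->
  H1norm cube (with_gradient (fun x => a * f x)) =
  (`|a| * fine (H1norm cube (with_gradient f)))%:E.
Proof.
move=> af; have aL := @coordalg_L2 R n.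
have fin h : coordalg h -> finite_components cube (with_gradient h).
  move=> ah; apply: finite_components_L2; first exact: aL.
  by move=> i; exact/aL/coordalg_partial.
have nZ h : coordalg h -> fine (L2norm cube (fun x => a * h x)) =
    `|a| * fine (L2norm cube h).
  move=> /aL Lh; rewrite L2normZ ?fineM//; last by case: Lh.
  by rewrite ge0_fin_numE ?L2norm_ge0; case: Lh.
rewrite !H1normE; [|exact: fin|exact/fin/coordalgZ].
congr _%:E; rewrite /= nZ//.
under eq_bigr => i _.
  rewrite (_ : partial i _ = fun x => a * partial i f x); last first.
    by apply/funext => x; rewrite partialZ//; exact: coordalg_derivable.
  rewrite nZ ?exprMn; last exact: coordalg_partial.
  over.
rewrite exprMn -mulr_sumr -mulrDr sqrtrM ?sqr_ge0// sqrtr_sqr normr_id.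
by [].
Qed.

(** The equation is stated on the open time interval, while integration by parts
is available on closed ones. *)
Lemma Rintegral_oo_cc (T : R) (h : R -> R) : continuous h ->
  \int[dt]_(t in `]0, T[) h t = \int[dt]_(t in `[0, T]) h t.
Proof.
move=> ch; have I : dt.-integrable `[0, T] (EFin \o h).
  apply: continuous_compact_integrable; first exact: segment_compact.
  exact: continuous_subspaceT.
rewrite Rintegral_itv_bndo_bndc; last first.
  by apply: (integrableS _ _ _ I) => //; apply: subset_itvW.
rewrite Rintegral_itv_obnd_cbnd//.
by apply: (integrableS _ _ _ I) => //; apply: subset_itv_oc_cc.
Qed.

Lemma heat_solution_eigenmode (T lam : R) f : 0 < T -> 0 <= lam ->
  coordalg f -> vanishing_on_boundary f ->
  (forall x, \sum_(i < n) partial i (partial i f) x = - lam * f x) ->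
  heat_solution cube T f (fun t x => expR (- lam * t) * f x).
Proof.
move=> T0 lam0 af vf eqf.
pose g (t : R) := expR (- lam * t).
pose g' (t : R) := - lam * g t.
have dg (t : R) : is_derive t 1 g (g' t).
  have dl : is_derive t 1 (fun s : R => - lam * s) (- lam).
    have -> : (fun s : R => - lam * s) = - lam *: id by [].
    by apply: is_derive_eq; exact: mulr1.
  by have := @is_derive1_comp _ expR _ t _ _ (is_derive_expR _) dl; rewrite mulrC.
have cg : continuous g by apply: derivable_continuous => t; case: (dg t).
have cg' : continuous g' by move=> t; apply: cvgMr; exact: cg.
have gB (t : R) : t \in `]0, T[ -> `|g t| <= 1.
  rewrite in_itv /= => /andP[t0 _]; rewrite ger0_norm ?expR_ge0// expR_le1.
  by rewrite mulNr oppr_le0 mulr_ge0// ltW.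
have g'B (t : R) : t \in `]0, T[ -> `|g' t| <= lam.
  move=> /gB gt; rewrite normrM normrN (ger0_norm lam0).
  by rewrite ler_piMr.
have Lf : L2 cube f by apply: continuous_L2_cube; exact: coordalg_continuous.
have aZ a : coordalg (fun x => a * f x) by exact: coordalgZ.
have vZ a : vanishing_on_boundary (fun x => a * f x) by exact: vanishingZ.
have LZ a : L2 cube (fun x => a * f x) by exact: L2Z.
have HL2 (w : @sobolev_pair R n) : H10 cube w -> L2 cube w.1 by case=> -[].
have bHm1 (h : R -> R) (B : R) : continuous h -> (forall t, t \in `]0, T[ -> `|h t| <= B) ->
    bochner_L2 T (Hm1 cube) (Hm1norm cube)
      (fun t => L2_Hm1 cube (fun x => h t * f x)).
  move=> ch hB.
  apply: (@bochner_L2_separated _ _ _ _ (fun a => L2_Hm1 cube (fun x => a * f x))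
    (fine (Hm1norm cube (L2_Hm1 cube f))) h B).
  - by move=> a; exact: L2_Hm1_Hm1.
  - move=> a; apply: Hm1normZ; last exact: Hm1norm_lty.
    by move=> w /HL2 Lw; rewrite /L2_Hm1 L2dotZl.
  - move=> a b; apply: Hm1normZ; last exact: Hm1norm_lty.
    by move=> w /HL2 Lw; rewrite !fctE /L2_Hm1 !L2dotZl// mulrBl.
  - exact: continuous_measurable_fun.
  - exact: hB.
exists (fun t => partial^~ (fun x => g t * f x)),
  (fun t => L2_Hm1 cube (fun x => g' t * f x)); split.
- apply: (@bochner_L2_separated _ _ _ _ (fun a => with_gradient (fun x => a * f x))
    (fine (H1norm cube (with_gradient f))) g 1).
  + by move=> a; exact: H10_with_gradient.
  + by move=> a; exact: H1norm_with_gradientZ.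
  + move=> a b; rewrite -H1norm_with_gradientZ//; congr H1norm.
    congr pair; apply/funext => i /=; first by rewrite !fctE mulrBl.
    apply/funext => x; rewrite !fctE !partialZ ?mulrBl//; exact: coordalg_derivable.
  + exact: continuous_measurable_fun.
  + exact: gB.
- split; [exact: bHm1 gB|exact: bHm1 g'B|].
  move=> theta [dtheta ctheta sub] w /HL2 Lw.
  set L := L2dot cube f w.1.
  have th0 (t : R) : ~ `]0, T[%classic t -> theta t = 0.
    move=> nt; apply/eqP/negPn/negP => h; apply: nt; apply: sub.
    exact: subset_closure.
  have dth (t : R) : derivable theta t 1 by exact: (dtheta 0%N).
  have cth : continuous theta by exact: derivable_continuous.
  have cdth : continuous (derive1 theta).
    by apply: derivable_continuous; exact: (dtheta 1%N).
  have dgL (t : R) : is_derive t 1 (fun s => g s * L) (g' t * L).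
    have -> : (fun s => g s * L) = L *: g by apply/funext => s; rewrite mulrC.
    by apply: is_derive_eq; rewrite mulrC.
  have bc (h : R -> R) : (forall t : R, derivable h t 1) -> derivable_oo_LRcontinuous h 0 T.
    move=> dh; have ch := derivable_continuous dh; split=> [t _ //| |].
    + by apply: cvg_at_right_filter; exact: ch.
    + by apply: cvg_at_left_filter; exact: ch.
  have IP := @Rintegration_by_parts R (fun t => g t * L) theta
    (fun t => g' t * L) (derive1 theta) 0 T T0.
  transitivity (\int[dt]_(t in `[0, T]) (g t * L * derive1 theta t)).
    rewrite -Rintegral_oo_cc; last first.
      move=> t; apply: cvgM; last exact: cdth.
      by apply: cvgMl; exact: cg.
    by apply: eq_Rintegral => t _; rewrite /L2_Hm1 L2dotZl// mulrC.
  rewrite IP.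
  + rewrite !th0 /= ?in_itv/= ?ltxx ?andbF// !mulr0 subrr sub0r; congr (- _).
    rewrite -Rintegral_oo_cc; last first.
      move=> t; apply: cvgM; last exact: cth.
      by apply: cvgMl; exact: cg'.
    by apply: eq_Rintegral => t _; rewrite /L2_Hm1 L2dotZl// mulrC.
  + by apply: continuous_subspaceT => t; apply: cvgMl; exact: cg'.
  + by apply: bc => t; case: (dgL t).
  + by move=> t _; rewrite derive1E; case: (dgL t).
  + exact: continuous_subspaceT.
  + exact: bc.
  + by [].
- apply: aeW => t _ w Hw.
  have := @weak_eigen_equation _ _ (fun x => g t * f x) lam w (aZ _) _ Hw.
  move=> ->.
    by have Lw := HL2 _ Hw; rewrite /L2_Hm1 !L2dotZl// /g'; ring.
  move=> x; rewrite mulrCA -eqf mulr_sumr; apply: eq_bigr => i _.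
  rewrite (_ : partial i (fun y => g t * f y) = fun y => g t * partial i f y).
    by apply: partialZ; apply: coordalg_derivable; exact: coordalg_partial.
  by apply/funext => y; apply: partialZ; exact: coordalg_derivable.
- split.
  + by move=> t _; exact: LZ.
  + move=> t _.
    have uE s : L2norm cube ((fun x => g s * f x) - (fun x => g t * f x)) =
        (`|g s - g t| * fine (L2norm cube f))%:E.
      rewrite (_ : _ - _ = fun x => (g s - g t) * f x); last first.
        by apply/funext => x; rewrite !fctE mulrBl.
      rewrite (L2normZ mcube _ Lf.1).
      by rewrite EFinM fineK// ge0_fin_numE ?L2norm_ge0; case: Lf.
    under eq_fun do rewrite uE.
    apply/cvg_EFin; first exact: nearW.
    rewrite -[X in _ --> X](mul0r (fine (L2norm cube f))); apply: cvgMl.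
    rewrite -[X in _ --> X](@normr0 _ R); apply: cvg_norm.
    rewrite -[X in _ --> X](subrr (g t)); apply: cvgB; last exact: cvg_cst.
    by apply: cvg_within_filter; exact: cg.
  + by apply: aeW => x _; rewrite mulr0 expR0 mul1r.
- move=> t _; apply: continuous_subspaceT.
  exact: coordalg_continuous.
Qed.

End heat_eigenmode.

(** * Products of sines *)

Section sine_modes.
Context {R : realType} {n : nat}.
Notation cube := (@unit_cube R n).
Implicit Types (k : 'I_n -> nat) (x : 'rV[R]_n).

Lemma is_derive_scale_arg (h : R -> R) (a t dh : R) :
  is_derive (a * t) 1 h dh -> is_derive t 1 (fun s => h (a * s)) (a * dh).
Proof.
move=> hd; have dl : is_derive t 1 (fun s => a * s) a.
  have -> : (fun s : R => a * s) = a *: id by [].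
  by apply: is_derive_eq; exact: mulr1.
by have := @is_derive1_comp _ h (fun s => a * s) t _ _ hd dl; rewrite mulrC.
Qed.

Lemma abs_sin_le (y : R) : 0 <= y -> `|sin y| <= y.
Proof.
move=> y0; have [c _] := @MVT_segment R sin cos 0 y y0 (fun t _ => is_derive_sin t)
  (continuous_subspaceT (@continuous_sin R)).
rewrite sin0 !subr0 => ->; rewrite normrM (ger0_norm y0) ler_piMl//.
exact: cos_max.
Qed.

(** Reflects t into 1 - t, so that the estimate of a mode near the face x_i = 0
also gives the one near x_i = 1. *)
Lemma abs_sin_natpi_sub (k : nat) (y : R) : `|sin (k%:R * pi - y)| = `|sin y|.
Proof.
elim: k => [|k IH]; first by rewrite mul0r sub0r sinN normrN.
rewrite -IH -natr1 mulrDl mul1r addrAC.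
by rewrite sinD sinpi cospi mulr0 addr0 mulrN1 normrN.
Qed.

Definition sine_mode k x : R := \prod_i sin ((k i)%:R * pi * x ord0 i).

Let sine_factor (m : nat) (t : R) : R := sin (m%:R * pi * t).

Let smooth_factor (m : nat) : smooth_real (sine_factor m).
Proof.
have -> : sine_factor m = (fun t : R => sin (m%:R * pi * t + 0)).
  by apply/funext => t; rewrite addr0.
by apply: smooth_real_affine; exact: smooth_real_sin.
Qed.

Let derive1_factor (m : nat) : derive1 (sine_factor m) =
  fun t : R => m%:R * pi * cos (m%:R * pi * t).
Proof.
apply/funext => t; rewrite derive1E.
by case: (is_derive_scale_arg (is_derive_sin (m%:R * pi * t))).
Qed.

Let derive2_factor (m : nat) : derive1 (derive1 (sine_factor m)) =
  fun t : R => - (m%:R * pi) ^+ 2 * sine_factor m t.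
Proof.
rewrite derive1_factor; apply/funext => t; rewrite derive1E.
have [d e] := is_derive_scale_arg (is_derive_cos (m%:R * pi * t)).
rewrite [LHS](@deriveZ _ _ _ (fun s : R => cos (m%:R * pi * s)))// e.
by rewrite /GRing.scale /= /sine_factor; ring.
Qed.

Lemma coordalg_sine_mode k : coordalg (sine_mode k).
Proof.
apply: (@coordalg_prod _ _ _ _ (fun i x => sine_factor (k i) (x ord0 i))) => i.
by apply: (@coordalg_coord _ _ i (sine_factor (k i))); exact: smooth_factor.
Qed.

(** The first derivative of a mode is again a product of functions of one
coordinate, the i-th factor being differentiated, so the product rule for such
products applies twice. *)
Lemma partial2_sine_mode k i x :
  partial i (partial i (sine_mode k)) x = - ((k i)%:R * pi) ^+ 2 * sine_mode k x.
Proof.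
pose h j := if j == i then derive1 (sine_factor (k j)) else sine_factor (k j).
have -> : partial i (sine_mode k) = fun y => \prod_j h j (y ord0 j).
  apply/funext => y; rewrite [LHS](@partial_prod_coord _ _ (fun j => sine_factor (k j))).
    rewrite [RHS](bigD1 i)//= {1}/h eqxx; congr (_ * _).
    by apply: eq_bigr => j /negbTE ji; rewrite /h ji.
  exact: smooth_real_derivable.
rewrite (@partial_prod_coord _ _ h); last first.
  rewrite /h eqxx; apply: smooth_real_derivable; exact: smooth_real_derive1.
rewrite {1}/h eqxx derive2_factor /sine_mode [in RHS](bigD1 i)//= mulrA.
by congr (_ * _); apply: eq_bigr => j /negbTE ji; rewrite /h ji.
Qed.

Lemma vanishing_sine_mode k : vanishing_on_boundary (sine_mode k).
Proof.
exists (\sum_i (k i)%:R * pi) => x cx i.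
have /andP[x0 x1] := cx i.
have pi0 := pi_ge0 R.
have kp0 j : 0 <= (k j)%:R * pi :> R by rewrite mulr_ge0.
have kS : (k i)%:R * pi <= \sum_i (k i)%:R * pi :> R.
  by rewrite (bigD1 i)//= lerDl sumr_ge0.
have le1 : `|sine_mode k x| <= `|sin ((k i)%:R * pi * x ord0 i)|.
  rewrite /sine_mode (bigD1 i)//= normrM ler_piMr// normr_prod.
  by apply: prodr_ile1 => j _; rewrite normr_ge0 sin_max.
have le2 (t : R) : 0 <= t -> `|sin ((k i)%:R * pi * t)| <= (\sum_i (k i)%:R * pi) * t.
  move=> t0; apply: (le_trans (abs_sin_le _)); first exact: mulr_ge0.
  exact: ler_wpM2r.
split; apply: (le_trans le1); first exact/le2/ltW.
rewrite -(abs_sin_natpi_sub (k i)) -{1}[(k i)%:R * pi]mulr1 -mulrBr.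
by apply: le2; rewrite subr_ge0 ltW.
Qed.

Lemma eigen_sum (I : Type) (r : seq I) (c : I -> R) (k : I -> 'I_n -> nat) (S : R) x :
  (forall p, \sum_i (k p i)%:R ^+ 2 = S) ->
  let f := fun y => \sum_(p <- r) c p * sine_mode (k p) y in
  \sum_i partial i (partial i f) x = - (pi ^+ 2 * S) * f x.
Proof.
move=> HS f; have am p := coordalg_sine_mode (k p).
have pf i : partial i f = fun y => \sum_(p <- r) c p * partial i (sine_mode (k p)) y.
  apply/funext => y; rewrite [LHS](@partial_sum _ _ _ r (fun p y => c p * sine_mode (k p) y)).
    by apply: eq_bigr => p _; rewrite partialZ//; exact: coordalg_derivable.
  by move=> p; exact: coordalgZ.
transitivity (\sum_(i < n) \sum_(p <- r)
    c p * (- ((k p i)%:R * pi) ^+ 2 * sine_mode (k p) x)).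
  apply: eq_bigr => i _; rewrite pf.
  rewrite [LHS](@partial_sum _ _ _ r (fun p y => c p * partial i (sine_mode (k p)) y)).
    apply: eq_bigr => p _; rewrite partialZ ?partial2_sine_mode//.
    by apply: coordalg_derivable; exact: coordalg_partial.
  by move=> p; apply: coordalgZ; exact: coordalg_partial.
rewrite exchange_big /= mulr_sumr; apply: eq_bigr => p _.
rewrite -mulr_sumr -mulr_suml (_ : \sum_(i < n) _ = - (pi ^+ 2 * S)).
  by rewrite mulrCA.
rewrite -(HS p) mulr_sumr -sumrN; apply: eq_bigr => i _.
by rewrite exprMn mulrC.
Qed.

End sine_modes.

(** * Many modes with the same eigenvalue, and their independence *)

Section common_eigenvalue.

(** The rational points ((q^2 - 1)/(q^2 + 1), 2q/(q^2 + 1)) of the unit circle, for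
q = 2, 3, ..., m + 1, are distinct and have positive coordinates; L is a common
denominator. *)
Lemma pythagorean_family (m : nat) : exists (a b : 'I_m -> nat) (L : nat),
  [/\ injective a, forall p, (0 < a p)%N, forall p, (0 < b p)%N &
      forall p, (a p ^ 2 + b p ^ 2 = L ^ 2)%N].
Proof.
pose q (p : 'I_m) := (p + 2)%N.
pose L := (\prod_(p < m) (q p ^ 2 + 1))%N.
pose d (p : 'I_m) := (L %/ (q p ^ 2 + 1))%N.
have Ld p : L = (d p * (q p ^ 2 + 1))%N.
  by rewrite /d divnK// /L (bigD1 p)//= dvdn_mulr.
have L0 : (0 < L)%N by apply: prodn_gt0 => p; rewrite addn1.
have d0 p : (0 < d p)%N by move: L0; rewrite (Ld p) muln_gt0 => /andP[].
have q2 p : (2 <= q p)%N by rewrite /q addn2.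
exists (fun p => d p * (q p ^ 2 - 1))%N, (fun p => d p * (2 * q p))%N, L.
split=> [p p' e|p|p|p].
- have h1 := Ld p; have h2 := Ld p'; have g1 := q2 p; have g2 := q2 p'.
  have dp := d0 p; have dp' := d0 p'.
  suff : q p = q p' by move=> /addIn /val_inj.
  move: e h1 h2 g1 g2 dp dp'; move: (d p) (d p') (q p) (q p') L0; clear.
  move: L => l x y u v l0 e h1 h2 u2 v2 x0 y0.
  have u1 : (1 <= u ^ 2)%N by rewrite expn_gt0; lia.
  have v1 : (1 <= v ^ 2)%N by rewrite expn_gt0; lia.
  have xU : (x <= x * u ^ 2)%N by rewrite leq_pmulr.
  have yV : (y <= y * v ^ 2)%N by rewrite leq_pmulr.
  rewrite !mulnBr !muln1 in e; rewrite mulnDr muln1 in h1; rewrite mulnDr muln1 in h2.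
  have xy : x = y by lia.
  subst y; have /eqP : (x * u ^ 2 = x * v ^ 2)%N by lia.
  by rewrite eqn_pmul2l// eqn_exp2r// => /eqP.
- rewrite muln_gt0 d0 subn_gt0 /=; have := q2 p; nia.
- rewrite !muln_gt0 d0 /=; have := q2 p; lia.
- rewrite (Ld p) !expnMn -mulnDr; congr (_ * _)%N.
  have := q2 p; move: (q p) => u u2.
  have : (1 <= u ^ 2)%N by rewrite expn_gt0; lia.
  rewrite (_ : 2 ^ 2 = 4)%N//.
  by move: (u ^ 2)%N => w w1; nia.
Qed.

End common_eigenvalue.

Section sine_independence.
Context {R : realType} {I : eqType}.
Implicit Types (a d : I -> R) (r : seq I).

Let is_derive_comb r (h dh : I -> R -> R) (t : R) :
  (forall p, is_derive t 1 (h p) (dh p t)) ->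
  is_derive t 1 (fun s => \sum_(p <- r) h p s) (\sum_(p <- r) dh p t).
Proof.
move=> H; elim: r => [|p r IH].
  under eq_fun do rewrite big_nil; rewrite big_nil; exact: is_derive_cst.
under eq_fun do rewrite big_cons; rewrite big_cons; exact: is_deriveD.
Qed.

Let derive_zero (F dF : R -> R) : (forall t : R, is_derive t 1 F (dF t)) ->
  (forall t, 0 < t < 1 -> F t = 0) -> forall t, 0 < t < 1 -> dF t = 0.
Proof.
move=> H F0 t t01; case: (H t) => _ <-.
rewrite (@near_eq_derive _ _ _ F (cst 0)) ?derive_cst//.
have : t \in `]0, 1[ by rewrite in_itv.
move=> /near_in_itvoo; apply: filterS => s; rewrite in_itv; exact: F0.
Qed.

(** The operator F |-> F'' + a_q^2 F kills the term of frequency a_q and multiplies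
each other one by a_q^2 - a_p^2, which is not zero: by induction on the number of
terms, only the coefficient of a_q can remain, and it is recovered at the point
pi / (2 a_q), which lies in (0, 1) since a_q >= pi. *)
Lemma sine_independence a : injective a -> (forall p, pi <= a p) ->
  forall r d, uniq r ->
  (forall t, 0 < t < 1 -> \sum_(p <- r) d p * sin (a p * t) = 0) ->
  forall p, p \in r -> d p = 0.
Proof.
move=> inja api; have pi0 := pi_gt0 R.
have a0 p : 0 < a p by exact: lt_le_trans (api p).
elim=> [//|q r IH] d /= /andP[qr ur] F0.
have d1 p (t : R) : is_derive t 1 (fun s => d p * sin (a p * s))
    (d p * (a p * cos (a p * t))).
  have h := is_derive_scale_arg (is_derive_sin (a p * t)).
  exact: (is_deriveZ _ h).
have d2 p (t : R) : is_derive t 1 (fun s => d p * (a p * cos (a p * s)))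
    (- (a p ^+ 2) * (d p * sin (a p * t))).
  have h := is_derive_scale_arg (is_derive_cos (a p * t)).
  apply: (is_derive_eq (is_deriveZ (d p) (is_deriveZ (a p) h))).
  by rewrite /GRing.scale /=; ring.
have F1 := derive_zero (fun t => @is_derive_comb (q :: r)
  (fun p s => d p * sin (a p * s)) (fun p s => d p * (a p * cos (a p * s))) t (fun p => d1 p t)) F0.
have F2 := derive_zero (fun t => @is_derive_comb (q :: r)
  (fun p s => d p * (a p * cos (a p * s)))
  (fun p s => - (a p ^+ 2) * (d p * sin (a p * s))) t (fun p => d2 p t)) F1.
have dr p : p \in r -> d p = 0.
  move=> pr.
  have /eqP : d p * (a q ^+ 2 - a p ^+ 2) = 0.
    apply: (IH (fun p => d p * (a q ^+ 2 - a p ^+ 2)) ur _ p pr) => t t01.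
    have := F0 t t01; have := F2 t t01; rewrite !big_cons => e2 e0.
    transitivity (a q ^+ 2 * (\sum_(j <- r) d j * sin (a j * t)) +
        \sum_(j <- r) - a j ^+ 2 * (d j * sin (a j * t))).
      by rewrite mulr_sumr -big_split /=; apply: eq_bigr => j _; ring.
    rewrite (_ : \sum_(j <- r) - _ * _ = a q ^+ 2 * (d q * sin (a q * t))); last first.
      by move: e2; rewrite mulNr => /eqP; rewrite addrC subr_eq0 => /eqP.
    by rewrite -mulrDr addrC e0 mulr0.
  rewrite mulf_eq0 => /orP[/eqP//|].
  rewrite subr_eq0 eqrXn2 ?ltW// => /eqP /inja qp.
  by rewrite qp pr in qr.
move=> p; rewrite inE => /predU1P[->|]; last exact: dr.
have h : 0 < pi / 2 / a q < 1.
  rewrite !divr_gt0//= ltr_pdivrMr// mul1r ltr_pdivrMr//.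
  by apply: (le_lt_trans (api q)); rewrite ltr_pMr// ltr1n.
have := F0 _ h; rewrite big_cons big_seq big1 => [|j /dr ->]; last by rewrite mul0r.
by rewrite addr0 mulrCA mulfV ?gt_eqF// mulr1 sin_pihalf mulr1.
Qed.

End sine_independence.

(** * Non-observability *)

Section positivity.
Context {R : realType} {n : nat}.
Notation dx := (@lebesgue_rV R n).
Notation cube := (@unit_cube R n).

(** By continuity f does not vanish on a small open box around x0, and a box has
positive measure. *)
Lemma Linfty_norm_gt0 (f : 'rV[R]_n -> R) x0 :
  continuous f -> cube x0 -> f x0 != 0 -> (0 < Linfty_norm cube f)%E.
Proof.
move=> cf cx fx; rewrite ltNge; apply/negP.
have mcube := @measurable_unit_cube R n.
have muT : (0 < dx [set: 'rV[R]_n])%E.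
  apply: (@lt_le_trans _ _ (dx cube)); first by rewrite lebesgue_unit_cube lte01.
  by apply: le_measure; rewrite ?inE.
rewrite /Linfty_norm unlock muT => /ess_supP [N [mN N0 sub]].
have [e e0 He] : exists2 e : R, 0 < e & forall x, ball x0 e x -> f x != 0.
  have : nbhs x0 [set x | f x != 0] by exact: (cvgr_neq0 _ (cf x0)).
  by move=> /nbhs_ballP[e /= e0 h]; exists e.
pose I (i : 'I_n) := `]Num.max 0 (x0 ord0 i - e), Num.min 1 (x0 ord0 i + e)[%classic.
have lenI i : Num.max 0 (x0 ord0 i - e) < Num.min 1 (x0 ord0 i + e).
  have /andP[h0 h1] := cx i.
  by rewrite gt_max !lt_min; apply/andP; split; apply/andP; split; lra.
have mB : measurable [set x : 'rV[R]_n | forall i, I i (x ord0 i)].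
  rewrite (_ : mkset _ = \bigcap_(i in [set: 'I_n])
      ((fun x : 'rV[R]_n => x ord0 i) @^-1` I i)); last first.
    by apply/seteqP; split => [x h i _|x h i]; exact: h.
  apply: fin_bigcap_measurable => // i _; rewrite -[X in measurable X]setTI.
  by apply: measurable_coord => //; exact: measurable_itv.
have BN : [set x : 'rV[R]_n | forall i, I i (x ord0 i)] `<=` N.
  move=> x xI; apply: sub => /=; rewrite lee_fin => fx0.
  have cubex : cube x.
    move=> i; have := xI i; rewrite /I /= in_itv /= gt_max lt_min.
    by move=> /andP[/andP[-> _] /andP[-> _]].
  have /He : ball x0 e x.
    split=> // i j; rewrite (ord1 i) -ball_normE /=; have := xI j.
    rewrite /I /= in_itv /= gt_max lt_min => /andP[/andP[_ h1] /andP[_ h2]].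
    by rewrite ltr_norml; apply/andP; split; lra.
  by rewrite patchE mem_set// normr_le0 in fx0; rewrite fx0.
have : (dx [set x : 'rV[R]_n | forall i, I i (x ord0 i)] <= dx N)%E.
  by apply: le_measure; rewrite ?inE.
rewrite N0 lebesgue_rV_box; last by move=> i; exact: measurable_itv.
apply/negP; rewrite -ltNge.
elim/big_ind : _ => [|a b a0 b0|i _]; first exact: lte01.
  exact: mule_gt0.
by rewrite lebesgue_measure_itv /= lte_fin lenI -EFinB lte_fin subr_gt0 lenI.
Qed.

End positivity.

Section eigenfunction_vanishing_on_finite_set.
Context {R : realType} {N : nat}.
Notation cube := (@unit_cube R N.+2).

(** Freeze all the coordinates but the first one: the last ones at 1/2, where the
corresponding sines are equal to 1, and the second one at a point t where the
factor of frequency b p0 is equal to 1.  There remains a combination of sines of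
the distinct frequencies a p. *)
Lemma sine_modes_independent (m : nat) (a b : 'I_m -> nat) (k : 'I_m -> 'I_N.+2 -> nat)
    (c : 'I_m -> R) :
  injective a -> (forall p, 0 < a p)%N -> (forall p, 0 < b p)%N ->
  (forall p i, k p i = if i == ord0 then a p else
     if i == lift ord0 ord0 then b p else 1%N) ->
  (forall x, cube x -> \sum_p c p * sine_mode (k p) x = 0) ->
  forall p, c p = 0.
Proof.
move=> inja a0 b0 kE f0 p0.
have pi0 := pi_gt0 R.
pose pt (s t : R) : 'rV[R]_N.+2 := \row_i (if i == ord0 then s else
  if i == lift ord0 ord0 then t else 2^-1).
have modeE p s t : sine_mode (k p) (pt s t) =
    sin ((a p)%:R * pi * s) * sin ((b p)%:R * pi * t).
  rewrite /sine_mode !big_ord_recl big1 ?mulr1 => [|i _].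
    by rewrite !mxE !kE.
  by rewrite mxE !kE /= mul1r sin_pihalf.
have ptc s t : 0 < s < 1 -> 0 < t < 1 -> cube (pt s t).
  move=> s01 t01 i; rewrite mxE; case: ifP => // _; case: ifP => // _.
  by rewrite invr_gt0 ltr0n invf_lt1 ?ltr1n.
have h : 0 < (2^-1 / (b p0)%:R : R) < 1.
  rewrite divr_gt0 ?ltr0n//= ltr_pdivrMr ?ltr0n// mul1r.
  by rewrite (@lt_le_trans _ _ 1) ?invf_lt1 ?ltr1n ?ler1n.
set t := 2^-1 / _ in h.
have /eqP : c p0 * sin ((b p0)%:R * pi * t) = 0.
  apply: (@sine_independence R _ (fun p => (a p)%:R * pi) _ _ (index_enum 'I_m)
    (fun p => c p * sin ((b p)%:R * pi * t))).
  - by move=> p q /(mulIf (lt0r_neq0 pi0)) /eqP; rewrite eqr_nat => /eqP /inja.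
  - by move=> p; rewrite ler_peMl ?(ltW pi0)// ler1n.
  - exact: index_enum_uniq.
  - move=> s s01; rewrite -[RHS](f0 _ (ptc s t s01 h)).
    by apply: eq_bigr => p _; rewrite modeE mulrAC mulrA.
  - exact: mem_index_enum.
(* The point t = 1/(2 b p0) was chosen to make this sine equal to 1. *)
rewrite (_ : _ * pi * t = pi / 2) ?sin_pihalf ?mulr1; first by move/eqP.
by rewrite /t; field; rewrite pnatr_eq0 -lt0n b0.
Qed.

(** There are m + 1 modes for m linear conditions, so that the matrix of values of
the modes at the given points has a nonzero vector in its left kernel. *)
Lemma eigenfunction_vanishing_on (m : nat) (y : 'I_m -> 'rV[R]_N.+2) :
  exists (f : 'rV[R]_N.+2 -> R) (lam : R),
    [/\ coordalg f, vanishing_on_boundary f, 0 <= lam,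
        forall x, \sum_i partial i (partial i f) x = - lam * f x &
        (forall j, f (y j) = 0) /\ exists2 x, cube x & f x != 0].
Proof.
have [a [b [L [inja a0 b0 abL]]]] := pythagorean_family m.+1.
pose k p (i : 'I_N.+2) := if i == ord0 then a p else
  if i == lift ord0 ord0 then b p else 1%N.
pose A : 'M[R]_(m.+1, m) := \matrix_(p, j) sine_mode (k p) (y j).
have /rowV0Pn[c /sub_kermxP cA c0] : kermx A != 0.
  by rewrite -mxrank_eq0 mxrank_ker -lt0n subn_gt0 ltnS rank_leq_col.
pose f x := \sum_p c ord0 p * sine_mode (k p) x.
exists f, (pi ^+ 2 * (L%:R ^+ 2 + N%:R)); split.
- by apply: coordalg_sum => p; apply: coordalgZ; exact: coordalg_sine_mode.
- by apply: vanishing_sum => p; apply: vanishingZ; exact: vanishing_sine_mode.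
- by rewrite mulr_ge0 ?addr_ge0 ?sqr_ge0.
- move=> x; apply: eigen_sum => p; rewrite !big_ord_recl /= addrA; congr (_ + _).
    by rewrite -!natrX -natrD abL.
  under eq_bigr => i _ do rewrite /k /= expr1n.
  by rewrite sumr_const card_ord.
- split=> [j|].
    have /rowP/(_ j) := cA; rewrite !mxE => <-.
    by apply: eq_bigr => p _; rewrite mxE.
  apply: contrapT => nex; move/eqP: c0; apply; apply/rowP => p; rewrite mxE.
  apply: (@sine_modes_independent _ a b k (c ord0)) => // x cx.
  by apply/eqP/negPn/negP => fx; apply: nex; exists x.
Qed.

End eigenfunction_vanishing_on_finite_set.

Theorem proposition3p2 (R : realType) (n : nat) (hn : (2 <= n)%N) (T : R)
    (hT : 0 < T) (omega : set 'rV[R]_n) (homega : finite_set omega)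
    (homegaD : omega `<=` unit_cube) :
  ~ observable unit_cube omega T.
Proof.
case: n hn omega homega homegaD => [//|[//|N]] _ omega homega _ [C [_ obs]].
have /finite_seqP[s omegaE] := homega.
have [f [lam [af vf lam0 eqf [fy [x0 cx0 fx0]]]]] :=
  eigenfunction_vanishing_on (fun j : 'I_(size s) => tnth (in_tuple s) j).
have f0 x : omega x -> f x = 0.
  rewrite omegaE /= => xs; have := fy (Ordinal (etrans (index_mem x s) xs)).
  by rewrite (tnth_nth x) /= nth_index.
have cf := coordalg_continuous af.
have := obs f _ (continuous_L2_cube cf)
  (heat_solution_eigenmode hT lam0 af vf eqf).
rewrite (_ : \int[_]_(t in _) _ = 0)%E; last first.
  apply: integral0_eq => t _; rewrite /sup_abs.
  rewrite (_ : _ `|` _ = [set 0%E]) ?ereal_sup1//.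
  apply/seteqP; split=> [_ [[x ox <-]|//]|_ ->]; last by right.
  by rewrite f0// mulr0 normr0.
rewrite mule0; apply/negP; rewrite -ltNge.
apply: (@Linfty_norm_gt0 _ _ _ x0) => //.
- exact/coordalg_continuous/coordalgZ.
- by rewrite mulf_neq0// gt_eqF// expR_gt0.
Qed.
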